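(* Let $n\ge d\ge 3$ and let $Q$ be a $d$-braxtope with vertex array $x_0<x_1<\cdots<x_n$. Then: 1. $Q$ is a braxial $d$-polytope. 2. The vertex figure $Q/x_0$ of $Q$ at $x_0$ is a $(d-1)$-multiplex with the induced ordering (the vertices of $Q/x_0$ being ordered as $\overline{x}_1<\overline{x}_2<\cdots<\overline{x}_n$, where $\overline{x}_u$ corresponds to the edge $[x_0,x_u]$ of $Q$). 3. If $n\le 2d-3$, then $Q$ is a $(2d-2-n)$-fold pyramid over an $(n-d+2)$-braxtope with the induced ordering. 4. For $-1\le j\le d$, $$f_j(Q)=\binom{d+1}{j+1}+(n-d)\left[\binom{d-1}{j}+\binom{d-2}{j-1}\right].$$ 5. $Q$ is elementary; that is, $f_{\{0,2\}}(Q)-3f_2(Q)+f_1(Q)-d f_0(Q)+\binom{d+1}{2}=0$.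
   Context: $[y_1,\ldots,y_s]$ denotes the convex hull of the points $y_1,\dots,y_s$. A vertex array of a polytope $P$ with (distinct) vertices $x_0,\ldots,x_n$ is a total ordering $x_0<x_1<\cdots<x_n$ of its vertex set. The induced ordering on the vertices of a face of $P$ is the restriction of this order to the vertices of the face. Braxtopes. For $d\le 2$, a $d$-braxtope is a $d$-simplex (with any ordering of its vertices). For $n\ge d\ge 3$, a $d$-polytope $P$ with $n+1$ vertices is a $d$-braxtope with vertex array $x_0<x_1<\cdots<x_n$ if the facets of $P$ are exactly $$T_i=[x_i,x_{i+1},\ldots,x_{i+d-1}]\quad\text{for } 0\le i\le n-d+1$$ and $$E_j=[x_0,x_{j-(d-2)},\ldots,x_{j-1},x_{j+1},\ldots,x_{j+(d-2)}]\quad\text{for } 2\le j\le n,$$ under the convention $x_t=x_0$ for $t\le 0$ and $x_t=x_n$ for $t\ge n$ (so $E_n=[x_0,x_{n-(d-2)},\ldots,x_{n-1},x_n]$). Braxial. A polytope $P$ is braxial if each proper face of $P$ is a braxtope (of its own dimension) with respect to the ordering induced by a fixed vertex array of $P$. Multiplex. A $d$-polytope $P$ with $n+1$ vertices is a $d$-multiplex with vertex array $x_0<x_1<\cdots<x_n$ if the facets of $P$ are exactly $[x_{i-d+1},\ldots,x_{i-1},x_{i+1},\ldots,x_{i+d-1}]$ for $0\le i\le n$, under the convention $x_t=x_0$ for $t\le 0$ and $x_t=x_n$ for $t\ge n$. (In item 2 this is applied in dimension $d-1$ to the $n$ ordered vertices $\overline{x}_1<\cdots<\overline{x}_n$, re-indexed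 from $0$ to $n-1$.) Pyramids. A pyramid over a polytope $B$ is $[B\cup\{v\}]$ for a point $v$ outside the affine hull of $B$; an $r$-fold pyramid is obtained by taking pyramids $r$ times successively. In item 3 the base is the convex hull of a subset of the vertices of $Q$, and the induced ordering on it is the one inherited from $x_0<\cdots<x_n$. Face numbers. $f_j(P)$ is the number of $j$-dimensional faces of a $d$-polytope $P$, $-1\le j\le d$, where $\emptyset$ is the face of dimension $-1$ and $P$ the face of dimension $d$. $f_{\{0,2\}}(P)$ is the number of pairs $(G_1,G_2)$ with $G_1\subset G_2$, $G_1$ a vertex and $G_2$ a $2$-face of $P$ (with $2$-faces allowed to be any faces of dimension $2$). Binomial coefficients $\binom{a}{b}$ with $b<0$ or $b>a\ge 0$ are $0$. *)

(* Defs.v *)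
From HB Require Import structures.
From mathcomp Require Export all_boot all_order all_algebra finmap.
From mathcomp Require Export all_classical all_reals.

Set Implicit Arguments.
Unset Strict Implicit.
Unset Printing Implicit Defensive.

Import Order.TTheory GRing.Theory Num.Theory.

Local Open Scope classical_set_scope.
Local Open Scope ring_scope.

Section Polytopes.
Variables (R : realType) (m : nat).
Local Notation V := 'rV[R]_m.

Definition dot (u v : V) : R := \sum_(i < m) u 0 i * v 0 i.

Definition conv (A : set V) : set V :=
  [set y | exists (k : nat) (p : 'I_k -> V) (w : 'I_k -> R),
     [/\ forall i, A (p i), forall i, 0 <= w i,
         \sum_(i < k) w i = 1 & y = \sum_(i < k) w i *: p i]].

Definition aff (A : set V) : set V :=
  [set y | exists (k : nat) (p : 'I_k -> V) (w : 'I_k -> R),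
     [/\ forall i, A (p i),
         \sum_(i < k) w i = 1 & y = \sum_(i < k) w i *: p i]].

Definition has_dim (A : set V) (j : int) : Prop :=
  (A = set0 /\ j = -1) \/
  exists (p : V) (U : {vspace V}),
    aff A = [set p + u | u in [set` U]] /\ j = (\dim U)%:Z.

Definition polytope (P : set V) : Prop := exists s : seq V, P = conv [set` s].

Definition hyperplane (c : V) (b : R) : set V := [set y | dot c y = b].

(* c = 0 gives the improper faces: b = 0 yields P and b = 1 yields set0. *)
Definition face (P F : set V) : Prop :=
  exists (c : V) (b : R),
    (forall y, P y -> dot c y <= b) /\ F = P `&` hyperplane c b.

Definition proper_face (P F : set V) : Prop := face P F /\ F <> P.

Definition vertex (P : set V) (v : V) : Prop := face P [set v].

Definition faces (P : set V) (j : int) : set (set V) :=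
  [set F | face P F /\ has_dim F j].

(* P is meant to be a d-polytope *)
Definition facets (d : int) (P : set V) : set (set V) := faces P (d - 1).

Definition affinely_independent (s : seq V) : Prop :=
  uniq s /\ forall v, v \in s -> ~ aff ([set` s] `\ v) v.

Definition simplex (d : int) (P : set V) : Prop :=
  exists s : seq V,
    [/\ affinely_independent s, (size s)%:Z = d + 1 & P = conv [set` s]].

(* the order of the vertices is the order of the sequence *)
Definition vertex_array (xs : seq V) (P : set V) : Prop :=
  [/\ polytope P, uniq xs & [set` xs] = [set v | vertex P v]].

Definition induced (xs : seq V) (F : set V) : seq V := [seq v <- xs | v \in F].

(* For xs = x_0, ..., x_n: the point x_t, with the convention that x_t = x_0
   for t <= 0 and x_t = x_n for t >= n. *)
Definition pt (xs : seq V) (t : int) : V :=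
  match t with
  | Posz k => nth 0 xs (minn k (size xs).-1)
  | Negz _ => nth 0 xs 0
  end.

Definition last_index (xs : seq V) : int := (size xs)%:Z - 1.

Definition brax_T (d : int) (xs : seq V) (i : int) : set V :=
  conv [set pt xs t | t in [set t : int | i <= t <= i + d - 1]].

Definition brax_E (d : int) (xs : seq V) (j : int) : set V :=
  conv (pt xs 0 |` [set pt xs t | t in
    [set t : int | j - (d - 2) <= t <= j + (d - 2) /\ t <> j]]).

Definition braxtope (d : int) (xs : seq V) (P : set V) : Prop :=
  vertex_array xs P /\
  if d <= 2 then simplex d P
  else [/\ has_dim P d, d <= last_index xs &
    facets d P =
      [set brax_T d xs i | i in
         [set i : int | 0 <= i <= last_index xs - d + 1]] `|`
      [set brax_E d xs j | j in [set j : int | 2 <= j <= last_index xs]]].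

(* xs is the fixed vertex array with respect to which P is braxial *)
Definition braxial (xs : seq V) (P : set V) : Prop :=
  vertex_array xs P /\
  forall F, proper_face P F ->
    exists2 d : int, has_dim F d & braxtope d (induced xs F) F.

Definition multiplex (d : int) (xs : seq V) (P : set V) : Prop :=
  [/\ vertex_array xs P, has_dim P d &
    facets d P =
      [set conv [set pt xs t | t in
              [set t : int | i - d + 1 <= t <= i + d - 1 /\ t <> i]]
        | i in [set i : int | 0 <= i <= last_index xs]]].

(* H = hyperplane c b strictly separates the vertex v of P from the other
   vertices of P; the vertex figure P/v is then P `&` H. *)
Definition separates_vertex (P : set V) (v c : V) (b : R) : Prop :=
  dot c v < b /\ forall w, vertex P w -> w <> v -> b < dot c w.

Definition segment (u v : V) : set V := conv [set u; v].

Definition edge (P : set V) (u v : V) : Prop :=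
  [/\ u <> v, face P (segment u v) & has_dim (segment u v) 1].

Definition pyramid (B P : set V) : Prop :=
  exists2 v : V, ~ aff B v & P = conv (B `|` [set v]).

Fixpoint fold_pyramid (r : nat) (B P : set V) : Prop :=
  if r is r'.+1 then exists2 B', fold_pyramid r' B B' & pyramid B' P
  else P = B.

(* fset_set A is empty when A is infinite; polytopes have finitely many faces. *)
Definition fnum (P : set V) (j : int) : nat := (#|` fset_set (faces P j)|)%N.

Definition fnum02 (P : set V) : nat :=
  (#|` fset_set [set G : set V * set V |
         [/\ faces P 0 G.1, faces P 2 G.2 & G.1 `<=` G.2]]|)%N.

Definition elementary (d : nat) (P : set V) : Prop :=
  (fnum02 P)%:Z - 3 * (fnum P 2)%:Z + (fnum P 1)%:Z - d%:Z * (fnum P 0)%:Z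
    + ('C(d.+1, 2))%:Z = 0.

End Polytopes.

(* 'C(a, b) with an integer lower argument, equal to 0 for b < 0 *)
Definition binz (a : nat) (b : int) : nat :=
  if b is Posz k then 'C(a, k) else 0%N.

(* Main.v *)
Require Import Defs.
From mathcomp Require Import all_boot all_order all_algebra finmap.
From mathcomp Require Import all_classical all_reals.
From mathcomp Require Import zify ring lra.

Set Implicit Arguments.
Unset Strict Implicit.
Unset Printing Implicit Defensive.

Import Order.TTheory GRing.Theory Num.Theory.

Local Open Scope classical_set_scope.
Local Open Scope ring_scope.

(** The whole face structure of a braxtope is forced by its list of facets, and
everything asserted here is read off from an explicit list of its faces.

A face is encoded by the set [X] of the indices of its vertices, and its
dimension by the rank [rk X] of those vertices in homogeneous coordinates, which
is the dimension plus one. From polytope theory four facts are enough: a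
polytope is the hull of its vertices (polytope_vertices, a consequence of
farkas); faces of faces and intersections of faces are faces (exposed_trans,
exposedI); the rank is strictly increasing on faces (rk_lt); and every vertex
missing from a face is also missing from a facet that contains this face
(exposed_in_facet), so that each face is an intersection of facets. In
particular no general theory of graded face lattices is used: strict chains of
faces that are long enough pin down all ranks.

For a braxtope the facets are the simplices [T_i], the simplex [E_n] and the
sets [E_j] with [2 <= j < n], where [E_j] consists of [x_0] and of the [x_k] with
[0 < |k - j| <= d - 2]. Intersecting them produces two sorts of faces.
- Short ones: all subsets of some [T_i], of [E_n], or of [x_0] together with
  [d - 2] consecutive vertices (short). Their vertices are affinely
  independent.
- Gapped ones: the intersection of the [E_j], [j] in [J], for a set [J]
  of indices in [2 .. n - 1] that differ by at most [d - 3] (gapped,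
  clustered). Adding an index to [J] makes the face strictly smaller, and a
  maximal [J] still leaves three vertices spanning a plane, so the rank is
  [d + 1 - #|J|] (gapped_rk). The case of an empty [J] is the polytope itself.
That nothing else occurs is a closure property (shapeI_facet). The two sorts are
disjoint and [J] can be recovered from its face, because a gapped face has two
vertices other than [x_0] whose indices are at least [d - 1] apart, and a short
face through [x_0] has none (gapped_long).

The five claims follow. (1) The faces of rank [d - 1] inside [E_j] are listed
and found to be the facets of a [(d-1)]-braxtope (facet_of_E); the other
facets are simplices, which are braxtopes for every order of their vertices; now
induct on [d] (braxtope_face). (2) A hyperplane cutting off [x_0] meets the
faces through [x_0], and only those matter: rank drops by one and the facets
become the [E_j] and [T_0] without [x_0], which is the defining list of a
multiplex (figure_multiplex). (3) If [n <= 2d - 3] then [E_(d-1)] omits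
only [x_(d-1)], so the polytope is a pyramid over this [(d-1)]-braxtope; iterate
(braxtope_pyramid). (4) Short faces avoiding [x_0], short faces through [x_0]
and the sets [J] are all families of sets whose elements have to stay close
to the largest one, and these are counted by their largest element
(card_spaced). (5) By (1) all two-dimensional faces are triangles, hence
[f_02 = 3 f_2], and the rest is an identity between [f_0] and [f_1]. *)

(** * Linear functionals and Farkas' lemma *)

Lemma choice_ex (A B : Type) (P : A -> B -> Prop) :
  (forall a, exists b, P a b) -> exists f, forall a, P a (f a).
Proof. by move=> /choice [f]; exists f. Qed.

Section Functionals.
Variables (R : realType) (m : nat).
Implicit Types (u v w : 'rV[R]_m) (a : R).

Lemma dotDl u v w : dot (u + v) w = dot u w + dot v w.
Proof. by rewrite /dot -big_split; apply: eq_bigr => i _ /=; rewrite mxE mulrDl. Qed.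

Lemma dotZl a u v : dot (a *: u) v = a * dot u v.
Proof. by rewrite /dot big_distrr; apply: eq_bigr => i _ /=; rewrite mxE mulrA. Qed.

Lemma dotC u v : dot u v = dot v u.
Proof. by apply: eq_bigr => i _; rewrite mulrC. Qed.

Lemma dotDr u v w : dot u (v + w) = dot u v + dot u w.
Proof. by rewrite dotC dotDl !(dotC u). Qed.

Lemma dotZr a u v : dot u (a *: v) = a * dot u v.
Proof. by rewrite dotC dotZl dotC. Qed.

Lemma dot0r u : dot u 0 = 0.
Proof. by rewrite -(scale0r 0) dotZr mul0r. Qed.

Lemma dot0l u : dot 0 u = 0.
Proof. by rewrite dotC dot0r. Qed.

Lemma dotNl u v : dot (- u) v = - dot u v.
Proof. by rewrite -scaleN1r dotZl mulN1r. Qed.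

Lemma dotNr u v : dot u (- v) = - dot u v.
Proof. by rewrite -scaleN1r dotZr mulN1r. Qed.

Lemma dot_sumr (J : Type) (r : seq J) (P : pred J) u (F : J -> 'rV[R]_m) :
  dot u (\sum_(i <- r | P i) F i) = \sum_(i <- r | P i) dot u (F i).
Proof.
apply: (big_morph (dot u)); [exact: dotDr | exact: dot0r].
Qed.

(** The functional is a coordinate of the component in a complement of [U]. *)
Lemma separate_subspace (U : {vspace 'rV[R]_m}) v : v \notin U ->
  exists c, (forall u, u \in U -> dot c u = 0) /\ dot c v != 0.
Proof.
move=> vU; pose f u := u - projv U u.
have fv : f v != 0.
  by apply: contra vU => /eqP /subr0_eq ->; exact: memv_proj.
have [i fi] : exists i, f v 0 i != 0.
  by have /rV0Pn := fv.
have fD u w : f (u + w) = f u + f w by rewrite /f linearD /= opprD addrACA.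
have fZ a u : f (a *: u) = a *: f u by rewrite /f linearZ /= scalerBr.
have f0 : f 0 = 0 by rewrite /f linear0 subr0.
pose c := \row_k (f (delta_mx 0 k) 0 i).
have cE u : dot c u = f u 0 i.
  rewrite {2}(row_sum_delta u) /dot.
  have -> : f (\sum_(j < m) u 0 j *: delta_mx 0 j)
          = \sum_(j < m) u 0 j *: f (delta_mx 0 j).
    by rewrite (big_morph f fD f0); apply: eq_bigr => j _; rewrite fZ.
  by rewrite summxE; apply: eq_bigr => j _; rewrite !mxE mulrC.
exists c; split; last by rewrite cE.
by move=> u uU; rewrite cE /f projv_id // subrr mxE.
Qed.

End Functionals.

(** Induction on the number of generators, for all generating families at once.
If the functional obtained for [X] without [a] is negative at [u a], project
everything along [u a] onto its kernel and apply the induction hypothesis to the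
projected vectors: a conic combination of the projections lifts to one that
uses [u a], and a separating functional is pulled back along the projection. *)
Lemma farkas (R : realType) (k : nat) (I : finType) (X : {set I})
    (u : I -> 'rV[R]_k) (v : 'rV[R]_k) :
  (exists w : I -> R, (forall i, 0 <= w i) /\ v = \sum_(i in X) w i *: u i) \/
  (exists g, (forall i, i \in X -> 0 <= dot g (u i)) /\ dot g v < 0).
Proof.
move: {2}#|X| (erefl #|X|) => N; elim: N X u v => [|N IH] X u v sN.
  move: sN => /cards0_eq ->; have [->|v0] := eqVneq v 0.
    by left; exists (fun=> 0); split => //; rewrite big1 // => i; rewrite inE.
  right; exists (- v); split => [i|]; first by rewrite inE.
  rewrite dotNl oppr_lt0 /dot.
  have [i vi] : exists i, v 0 i != 0 by have /rV0Pn := v0.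
  rewrite (bigD1 i) //= ltr_pwDl //.
    by rewrite -expr2 exprn_even_gt0.
  by apply: sumr_ge0 => *; rewrite -expr2 sqr_ge0.
have [a aX] : exists a, a \in X by apply/set0Pn; rewrite -cards_eq0 sN.
have sN' : #|X :\ a| = N by apply/eqP; rewrite -eqSS -sN (cardsD1 a X) aX.
have inXa i : (i \in X) && (i != a) = (i \in X :\ a) by rewrite !inE andbC.
have [[w [w0 ->]]|[g [gs gv]]] := IH _ u v sN'.
  left; exists (fun i => if i == a then 0 else w i); split.
    by move=> i; case: eqP.
  rewrite [RHS](bigD1 a) //= eqxx scale0r add0r; apply: eq_big => // i.
  by rewrite !inE; case: eqP.
have [ga|ga] := leP 0 (dot g (u a)).
  right; exists g; split=> // i iX; have [->//|ia] := eqVneq i a.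
  by apply: gs; rewrite !inE ia.
pose pr y := y - (dot g y / dot g (u a)) *: u a.
have [[w [w0 vE]]|[h [hs hv]]] := IH _ (pr \o u) (pr v) sN'.
  pose c0 := dot g v / dot g (u a)
    - \sum_(i in X :\ a) w i * (dot g (u i) / dot g (u a)).
  left; exists (fun i => if i == a then c0 else w i); split.
    move=> i; case: eqP => // _; rewrite /c0 subr_ge0.
    apply: (@le_trans _ _ 0).
      apply: sumr_le0 => j jX; apply: mulr_ge0_le0 => //.
      by apply: mulr_ge0_le0; [exact: gs | rewrite invr_le0 ltW].
    by apply: mulr_le0; [exact: ltW | rewrite invr_le0 ltW].
  rewrite (bigD1 a) //= eqxx.
  transitivity (pr v + (dot g v / dot g (u a)) *: u a); first by rewrite subrK.
  rewrite vE /c0 scalerBl [LHS]addrC -[RHS]addrA; congr (_ + _).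
  rewrite scaler_suml -sumrN [in RHS](eq_bigl _ _ inXa) -big_split.
  apply: eq_bigr => i /=; rewrite !inE => /andP[/negPf -> _] /=.
  by rewrite /pr scalerBr scalerA addrC.
right; exists (h - (dot h (u a) / dot g (u a)) *: g).
have E y : dot (h - (dot h (u a) / dot g (u a)) *: g) y = dot h (pr y).
  rewrite /pr dotDl dotDr dotNl dotNr dotZl dotZr.
  by field; rewrite lt_eqF.
split=> [i iX|]; rewrite E //.
have [->|ia] := eqVneq i a; last by apply: hs; rewrite !inE ia.
by rewrite /pr divff ?lt_eqF // scale1r subrr dot0r.
Qed.

Section Affine.
Variables (R : realType) (m : nat).
Local Notation V := 'rV[R]_m.

(** Homogeneous coordinates: affine functionals on the space become the linear
functionals [ev g], and affine hulls become linear spans. *)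
Definition lift1 (y : V) : 'rV[R]_(m + 1) := row_mx y 1%:M.
Definition ev (g : 'rV[R]_(m + 1)) (y : V) : R := dot g (lift1 y).

Lemma dot_row_mx (c : V) (b : R) (y : V) (t : R) :
  dot (row_mx c b%:M) (row_mx y t%:M) = dot c y + b * t.
Proof.
rewrite /dot big_split_ord big_ord1 /= !row_mxEr !mxE /= !mulr1n; congr (_ + _).
by apply: eq_bigr => i _; rewrite !row_mxEl.
Qed.

Lemma ev_affine (g : 'rV[R]_(m + 1)) : exists c b, forall y, ev g y = dot c y - b.
Proof.
exists (lsubmx g), (- rsubmx g 0 0) => y.
rewrite /ev -{1}(hsubmxK g) [in LHS](mx11_scalar (rsubmx g)) dot_row_mx.
by rewrite mulr1 opprK.
Qed.

Lemma affine_ev (c : V) (b : R) : exists g, forall y, ev g y = dot c y - b.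
Proof.
by exists (row_mx c (- b)%:M) => y; rewrite /ev dot_row_mx mulr1.
Qed.

Lemma evD g h y : ev (g + h) y = ev g y + ev h y.
Proof. exact: dotDl. Qed.

Lemma evZ a g y : ev (a *: g) y = a * ev g y.
Proof. exact: dotZl. Qed.

Lemma evN g y : ev (- g) y = - ev g y.
Proof. exact: dotNl. Qed.

Lemma lift1_sum (J : finType) (w : J -> R) (p : J -> V) :
  \sum_i w i *: lift1 (p i) = row_mx (\sum_i w i *: p i) (\sum_i w i)%:M.
Proof.
apply/rowP => k; rewrite summxE; case: (split_ordP k) => l ->.
  rewrite row_mxEl summxE; apply: eq_bigr => i _.
  by rewrite /lift1 mxE row_mxEl [RHS]mxE.
rewrite row_mxEr (ord1 l) [RHS]mxE /= mulr1n.
by apply: eq_bigr => i _; rewrite /lift1 mxE row_mxEr mxE /= mulr1.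
Qed.

Lemma lift1_comb (J : finType) (w : J -> R) (p : J -> V) : \sum_i w i = 1 ->
  lift1 (\sum_i w i *: p i) = \sum_i w i *: lift1 (p i).
Proof. by move=> w1; rewrite lift1_sum w1. Qed.

Lemma ev_comb (J : finType) (w : J -> R) (p : J -> V) g : \sum_i w i = 1 ->
  ev g (\sum_i w i *: p i) = \sum_i w i * ev g (p i).
Proof.
move=> w1; rewrite /ev lift1_comb // dot_sumr.
by apply: eq_bigr => i _; rewrite dotZr.
Qed.

Lemma homog_inj (w1 w2 : R) (y1 y2 : V) :
  row_mx y1 w1%:M = row_mx y2 w2%:M -> y1 = y2 /\ w1 = w2.
Proof.
move=> E; have [-> /matrixP /(_ 0 0)] := eq_row_mx E.
by rewrite !mxE eqxx /= !mulr1n.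
Qed.

End Affine.

(** * Convex hulls of finite families and their dimension *)

Section Hull.
Variables (R : realType) (m : nat) (I : finType).
Local Notation V := 'rV[R]_m.
Implicit Types (x : I -> V) (X Y Z : {set I}).

Definition hull x X : set V := conv (x @` [set` X]).

(** Gathering the weights of equal points turns any convex combination into one
indexed by [I] itself. *)
Lemma hullP x X y : hull x X y <->
  exists w : I -> R, [/\ forall i, 0 <= w i, forall i, i \notin X -> w i = 0,
    \sum_i w i = 1 & y = \sum_i w i *: x i].
Proof.
split=> [[k [p [w [Ap w0 w1 ->]]]]|[w [w0 wX w1 ->]]].
  have [f fP] : exists f : 'I_k -> I, forall l, f l \in X /\ x (f l) = p l.
    apply: (@choice_ex _ _ (fun l i => i \in X /\ x i = p l)) => l.
    by have [i iX xi] := Ap l; exists i.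
  exists (fun i => \sum_(l | f l == i) w l); split.
  - by move=> i; apply: sumr_ge0.
  - move=> i iX; rewrite big_pred0 // => l; apply: contraNF iX => /eqP <-.
    by case: (fP l).
  - by rewrite -w1 [RHS](partition_big f xpredT).
  rewrite (partition_big f xpredT) //=; apply: eq_bigr => i _.
  by rewrite scaler_suml; apply: eq_bigr => l /eqP <-; case: (fP l) => _ ->.
have sumX (T : nmodType) (F : I -> T) : (forall i, i \notin X -> F i = 0) ->
    \sum_i F i = \sum_(l < #|X|) F (enum_val l).
  move=> F0; rewrite -(@big_enum_val _ _ _ _ (mem X) F) /=
    [LHS](bigID (mem X)) /= [X in _ + X]big1 ?addr0.
  - by [].
  - by move=> i /F0.
exists #|X|, (fun l => x (enum_val l)), (fun l => w (enum_val l)); split => //.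
- by move=> l; exists (enum_val l) => //; exact: enum_valP.
- by rewrite -sumX.
- by rewrite sumX // => i /wX ->; rewrite scale0r.
Qed.

Lemma conv_sub_hull x X (A : set V) : A `<=` hull x X -> conv A `<=` hull x X.
Proof.
move=> AX y [k [p [w [Ap w0 w1 ->]]]].
have [f fP] : exists f : 'I_k -> I -> R, forall l,
   [/\ forall i, 0 <= f l i, forall i, i \notin X -> f l i = 0,
    \sum_i f l i = 1 & p l = \sum_i f l i *: x i].
  apply: (@choice_ex _ _ (fun l (v : I -> R) => [/\ forall i, 0 <= v i,
    forall i, i \notin X -> v i = 0, \sum_i v i = 1 & p l = \sum_i v i *: x i])).
  by move=> l; have /hullP [v ?] := AX _ (Ap l); exists v.
apply/hullP; exists (fun i => \sum_l w l * f l i); split.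
- by move=> i; apply: sumr_ge0 => l _; apply: mulr_ge0 => //; case: (fP l).
- by move=> i iX; rewrite big1 // => l _; case: (fP l) => _ -> //; rewrite mulr0.
- rewrite exchange_big -[RHS]w1 /=; apply: eq_bigr => l _.
  by rewrite -big_distrr /=; case: (fP l) => _ _ -> _; rewrite mulr1.
transitivity (\sum_l \sum_i (w l * f l i) *: x i).
  apply: eq_bigr => l _; case: (fP l) => _ _ _ ->; rewrite scaler_sumr.
  by apply: eq_bigr => i _; rewrite scalerA.
by rewrite exchange_big; apply: eq_bigr => i _; rewrite scaler_suml.
Qed.

Lemma sub_conv (A : set V) : A `<=` conv A.
Proof.
move=> y Ay; exists 1%N, (fun=> y), (fun=> 1); split => //.
  by rewrite big_ord1.
by rewrite big_ord1 scale1r.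
Qed.

Lemma mem_hull x X i : i \in X -> hull x X (x i).
Proof. by move=> iX; apply: sub_conv; exists i. Qed.

Lemma hullS x X Y : X \subset Y -> hull x X `<=` hull x Y.
Proof.
move=> /fintype.subsetP XY; apply: conv_sub_hull => _ [i /= iX <-].
by apply: mem_hull; apply: XY.
Qed.

Lemma hull0 x : hull x finset.set0 = set0.
Proof.
apply/seteqP; split => // y /hullP [w [_ w0 w1 _]].
by move: w1; rewrite big1 => [|i _]; [move=> /esym/eqP; rewrite oner_eq0 | rewrite w0 ?inE].
Qed.

Lemma hull1 x i : hull x [set i]%SET = [set x i].
Proof.
apply/seteqP; split => [y /hullP [w [_ w0 w1 ->]]|_ ->]; last by apply: mem_hull; rewrite inE.
move: w1; rewrite (bigD1 i) //= [in X in _ -> X](bigD1 i) //= !big1.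
- by rewrite !addr0 => ->; rewrite scale1r.
- by move=> j ji; rewrite w0 ?scale0r // inE.
- by move=> j ji; rewrite w0 // inE.
Qed.

Lemma hull_neq0 x X : hull x X = set0 -> X = finset.set0.
Proof.
move=> X0; apply/eqP; apply/set0Pn => -[i /(mem_hull x)]; by rewrite X0.
Qed.

Lemma polytope_hull x X : polytope (hull x X).
Proof.
exists [seq x i | i <- enum X]; congr conv; apply/seteqP; split => [_ [i iX <-]|y].
  by apply: map_f; rewrite mem_enum.
by move=> /mapP [i]; rewrite mem_enum => iX ->; exists i.
Qed.

Definition hspan x X : {vspace 'rV[R]_(m + 1)} :=
  (\sum_(i in X) <[lift1 (x i)]>)%VS.
(** The dimension plus one, which avoids negative numbers. *)
Definition rk x X : nat := \dim (hspan x X).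

Lemma mem_hspan x X i : i \in X -> lift1 (x i) \in hspan x X.
Proof. by move=> iX; apply: (subvP (sumv_sup i iX (subvv _))); apply: memv_line. Qed.

Lemma hspan_sub x X (U : {vspace 'rV[R]_(m + 1)}) :
  (forall i, i \in X -> lift1 (x i) \in U) -> (hspan x X <= U)%VS.
Proof. by move=> XU; apply/subv_sumP => i /XU; rewrite memvE. Qed.

Lemma hspanS x X Y : X \subset Y -> (hspan x X <= hspan x Y)%VS.
Proof. by move=> /fintype.subsetP XY; apply: hspan_sub => i /XY; apply: mem_hspan. Qed.

Lemma hull_hspan x X y : hull x X y -> lift1 y \in hspan x X.
Proof.
move=> /hullP [w [_ w0 w1 ->]]; rewrite lift1_comb //; apply: memv_suml => i _.
have [iX|/w0 ->] := boolP (i \in X); last by rewrite scale0r mem0v.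
by apply: memvZ; apply: mem_hspan.
Qed.

Lemma aff_image x X y : aff (x @` [set` X]) y <-> lift1 y \in hspan x X.
Proof.
split=> [[k [p [w [Ap w1 ->]]]]|].
  rewrite lift1_comb //; apply: memv_suml => i _.
  by apply: memvZ; have [j jX <-] := Ap i; apply: mem_hspan.
move=> /memv_sumP [v vX E].
have [w wE] : exists w : I -> R, forall i, i \in X -> v i = w i *: lift1 (x i).
  apply: (@choice_ex _ _ (fun i a => i \in X -> v i = a *: lift1 (x i))) => i.
  have [iX|iX] := boolP (i \in X); last by exists 0.
  by have /vlineP [a ->] := vX i iX; exists a.
move: E; under eq_bigr => i iX do rewrite wE //.
rewrite (@big_enum_val _ _ _ _ (mem X) (fun i => w i *: lift1 (x i))) lift1_sum.
move=> /homog_inj [-> w1].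
exists #|X|, (fun l => x (enum_val l)), (fun l => w (enum_val l)); split => //.
by move=> l; exists (enum_val l) => //; exact: enum_valP.
Qed.

Lemma affS (A B : set V) : A `<=` B -> aff A `<=` aff B.
Proof. by move=> AB y [k [p [w [Ap w1 ->]]]]; exists k, p, w; split => // i; apply: AB. Qed.

Lemma aff_hull x X y : aff (hull x X) y <-> lift1 y \in hspan x X.
Proof.
split=> [[k [p [w [Ap w1 ->]]]]|].
  rewrite lift1_comb //; apply: memv_suml => i _.
  by apply: memvZ; apply: hull_hspan.
by move=> /aff_image; apply: affS; exact: sub_conv.
Qed.

(** The embedding of directions, at height 0, next to points, at height 1. *)
Definition emb : 'Hom('rV[R]_m, 'rV[R]_(m + 1)) :=
  linfun (mulmxr (row_mx 1%:M 0)).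

Lemma embE u : emb u = row_mx u 0.
Proof. by rewrite lfunE /= mul_mx_row mulmx1 mulmx0. Qed.

Lemma emb_inj : lker emb == 0%VS.
Proof.
apply/lker0P => u v; rewrite !embE => E.
by have [] := eq_row_mx E.
Qed.

Lemma lift1B y z : lift1 y - lift1 z = emb (y - z).
Proof. by rewrite embE /lift1 opp_row_mx add_row_mx subrr. Qed.

Lemma lift1_notin_emb y U : lift1 y \notin (emb @: U)%VS.
Proof.
apply/negP => /memv_imgP [u _]; rewrite embE => /eq_row_mx [_] /matrixP /(_ 0 0).
by rewrite !mxE eqxx; apply/eqP; rewrite oner_eq0.
Qed.

Lemma rk0 x : rk x finset.set0 = 0%N.
Proof. by rewrite /rk /hspan big1 ?dimv0 // => i; rewrite inE. Qed.

Lemma dim_add_line k (U : {vspace 'rV[R]_k}) v : v \notin U ->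
  \dim (<[v]> + U)%VS = (\dim U).+1.
Proof.
move=> vU; rewrite dimv_disjoint_sum.
  by rewrite dim_vline; case: eqP vU => // ->; rewrite mem0v.
apply/eqP; rewrite -subv0; apply/subvP => w; rewrite memv_cap => /andP[/vlineP [a ->]].
have [->|a0] := eqVneq a 0; first by move=> _; rewrite scale0r mem0v.
by move=> /(memvZ a^-1); rewrite scalerA mulVf // scale1r (negPf vU).
Qed.

(** If the affine hull is [p + U], the homogeneous span is the direct sum of the
line of [p] and of a copy of [U]. This also shows that the dimension in the
sense of [has_dim] is unique. *)
Lemma has_dim_hull x X j : has_dim (hull x X) j <-> j = (rk x X)%:Z - 1.
Proof.
have rkE k : has_dim (hull x X) k -> k = (rk x X)%:Z - 1.
  case=> [[/hull_neq0 -> ->]|[p [U [aE ->]]]]; first by rewrite rk0.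
  have inaff y : (lift1 y \in hspan x X) <-> (exists2 u, u \in U & p + u = y).
    by rewrite -aff_hull aE.
  have -> : rk x X = (\dim U).+1; last by lia.
  have -> : rk x X = \dim (<[lift1 p]> + emb @: U)%VS.
    congr (\dim _); apply/eqP; rewrite eqEsubv; apply/andP; split.
      apply: hspan_sub => i iX; have /inaff [u uU <-] := mem_hspan x iX.
      rewrite -(subrK (lift1 p) (lift1 (p + u))) lift1B addrC; apply: memv_add.
        exact: memv_line.
      by apply: memv_img; rewrite addrC addKr.
    have pX : lift1 p \in hspan x X by apply/inaff; exists 0; rewrite ?mem0v ?addr0.
    rewrite subv_add -memvE pX; apply/subvP => _ /memv_imgP [u uU ->].
    have -> : u = (p + u) - p by rewrite addrC addKr.
    rewrite -lift1B; apply: rpredB => //.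
    by apply/inaff; exists u.
  by rewrite dim_add_line ?lift1_notin_emb // limg_dim_eq ?(eqP emb_inj) ?capv0.
split=> [/rkE //|->]; have [X0|[i iX]] := finset.set_0Vmem X.
  by left; rewrite X0 hull0 rk0.
pose U := (emb @^-1: hspan x X)%VS.
suff dimU : has_dim (hull x X) (\dim U)%:Z by rewrite -(rkE _ dimU).
right; exists (x i), U; split => //.
apply/seteqP; split=> y.
  move=> /aff_hull yX; exists (y - x i); last by rewrite addrC subrK.
  by rewrite /= /U -memv_preim -lift1B rpredB // mem_hspan.
move=> [u /=]; rewrite /U -memv_preim => uX <-; apply/aff_hull.
rewrite -(subrK (lift1 (x i)) (lift1 (x i + u))) lift1B [x i + u]addrC addrK.
by rewrite rpredD // mem_hspan.
Qed.

End Hull.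

(** * Faces as exposed sets of indices *)

Section Exposed.
Variables (R : realType) (m : nat) (I : finType).
Local Notation V := 'rV[R]_m.
Variable x : I -> V.
Implicit Types (X Y Z : {set I}) (g : 'rV[R]_(m + 1)).

(** The faces of the hull of [Y], seen as sets of indices: by [face_hullP] each
face is the hull of the points of [Y] at which its functional vanishes. *)
Definition exposed Y X : Prop := exists g,
  (forall i, i \in Y -> ev g (x i) <= 0) /\
  X = [set i in Y | ev g (x i) == 0]%SET.

Lemma hull_le0 Y g : (forall i, i \in Y -> ev g (x i) <= 0) ->
  forall y, hull x Y y -> ev g y <= 0.
Proof.
move=> gY _ /hullP [w [w0 wY w1 ->]]; rewrite ev_comb //.
apply: sumr_le0 => i _; have [iY|/wY ->] := boolP (i \in Y); last by rewrite mul0r.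
by rewrite mulr_ge0_le0 ?gY.
Qed.

Lemma hull_eq0 Y g : (forall i, i \in Y -> ev g (x i) <= 0) ->
  hull x Y `&` [set y | ev g y = 0] = hull x [set i in Y | ev g (x i) == 0]%SET.
Proof.
move=> gY; apply/seteqP; split=> [y [/hullP [w [w0 wY w1 ->]] /= E]|y].
  apply/hullP; exists w; split => // i; rewrite inE negb_and => /orP[/wY //|gi].
  have [iY|/wY //] := boolP (i \in Y).
  have /eqP := E; rewrite ev_comb // -oppr_eq0 -sumrN psumr_eq0 => [/allP|k _].
    move=> /(_ i); rewrite mem_index_enum oppr_eq0 mulf_eq0 (negPf gi) orbF.
    by move=> /(_ isT) /eqP.
  rewrite oppr_ge0; have [kY|/wY ->] := boolP (k \in Y); last by rewrite mul0r.
  by rewrite mulr_ge0_le0 ?gY.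
move=> /hullP [w [w0 wY w1 ->]]; split.
  apply/hullP; exists w; split => // i iY; apply: wY.
  by rewrite inE (negPf iY).
rewrite /= ev_comb // big1 // => i _.
have [|/wY ->] := boolP (i \in [set i in Y | ev g (x i) == 0]%SET); last by rewrite mul0r.
by rewrite inE => /andP[_ /eqP ->]; rewrite mulr0.
Qed.

Lemma face_hullP Y F : face (hull x Y) F <-> exists2 X, exposed Y X & F = hull x X.
Proof.
split=> [[c [b [cb ->]]]|[_ [g [gY ->]] ->]].
  have [g gE] := affine_ev c b.
  have gY i : i \in Y -> ev g (x i) <= 0.
    by move=> iY; rewrite gE subr_le0; apply: cb; apply: mem_hull.
  exists [set i in Y | ev g (x i) == 0]%SET; first by exists g.
  rewrite -hull_eq0 //; congr (_ `&` _); apply/seteqP; split=> y /=.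
    by rewrite gE => ->; rewrite subrr.
  by rewrite gE => /subr0_eq.
have [c [b gE]] := ev_affine g.
exists c, b; split.
  by move=> y /(hull_le0 gY); rewrite gE subr_le0.
rewrite -hull_eq0 //; congr (_ `&` _); apply/seteqP; split=> y /=.
  by rewrite gE => /subr0_eq.
by rewrite gE => ->; rewrite subrr.
Qed.

Lemma exposed_sub Y X : exposed Y X -> X \subset Y.
Proof. by move=> [g [_ ->]]; apply/fintype.subsetP => i; rewrite inE => /andP[]. Qed.

Lemma exposed_refl Y : exposed Y Y.
Proof.
exists 0; split=> [i _|]; first by rewrite /ev dot0l.
by apply/setP => i; rewrite inE /ev dot0l eqxx andbT.
Qed.

Lemma exposedI Y X1 X2 : exposed Y X1 -> exposed Y X2 -> exposed Y (X1 :&: X2).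
Proof.
move=> [g1 [g1Y ->]] [g2 [g2Y ->]]; exists (g1 + g2); split=> [i iY|].
  by rewrite evD; have := g1Y i iY; have := g2Y i iY; lra.
apply/setP => i; rewrite !inE evD; have [iY|//] := boolP (i \in Y).
by rewrite /= naddr_eq0 ?g1Y ?g2Y.
Qed.

(** A large multiple of the functional of [Y] outweighs the functional of [X] at
the finitely many points outside [Y]. *)
Lemma exposed_trans Z Y X : exposed Z Y -> exposed Y X -> exposed Z X.
Proof.
move=> [g [gZ YE]] [h [hY ->]].
(* Larger than the ratio of the two functionals at any point outside [Y]. *)
pose N : R := 1 + \sum_(i in Z) `|ev h (x i)| / `|ev g (x i)|.
have N1 i : i \in Z -> ev g (x i) != 0 -> N * ev g (x i) + ev h (x i) < 0.
  move=> iZ gi; have gi0 : ev g (x i) < 0 by rewrite lt_neqAle gi gZ.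
  have : 1 + `|ev h (x i)| / `|ev g (x i)| <= N.
    rewrite lerD2l (bigD1 i) //= lerDl; apply: sumr_ge0 => k _.
    by rewrite mulr_ge0 // invr_ge0.
  clearbody N; rewrite -(ler_nM2r gi0) mulrDl mul1r (ltr0_norm gi0) => H.
  have E : `|ev h (x i)| / - ev g (x i) * ev g (x i) = - `|ev h (x i)|.
    by field.
  have := ler_norm (ev h (x i)); rewrite E in H; lra.
have inY i : (i \in Y) = (i \in Z) && (ev g (x i) == 0) by rewrite YE inE.
exists (N *: g + h); split=> [i iZ|].
  rewrite evD evZ; have [gi|gi] := eqVneq (ev g (x i)) 0; last exact/ltW/N1.
  by rewrite gi mulr0 add0r; apply: hY; rewrite inY iZ gi eqxx.
apply/setP => i; rewrite !inE inY evD evZ; have [iZ|//] := boolP (i \in Z) => /=.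
have [gi|gi] /= := eqVneq (ev g (x i)) 0; first by rewrite gi mulr0 add0r.
by apply/esym/negbTE; rewrite lt_eqF // N1.
Qed.

Lemma exposed_restrict Z Y X : X \subset Y -> Y \subset Z -> exposed Z X -> exposed Y X.
Proof.
move=> /fintype.subsetP XY /fintype.subsetP YZ [g [gZ XE]]; exists g; split=> [i /YZ /gZ //|].
apply/setP => i; rewrite inE; have [iY|iY] := boolP (i \in Y) => /=.
  by rewrite XE inE YZ.
by apply: contraNF iY => /XY.
Qed.

Lemma exposed_notin_hspan Y X i : exposed Y X -> i \in Y -> i \notin X ->
  lift1 (x i) \notin hspan x X.
Proof.
move=> [g [gY ->]] iY; rewrite inE iY /= => gi.
apply: contra gi => /memv_sumP [v vX E]; rewrite /ev E dot_sumr big1 // => k kX.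
have /vlineP [a ->] := vX k kX.
by move: kX; rewrite inE dotZr => /andP[_ /eqP]; rewrite /ev => ->; rewrite mulr0.
Qed.

Lemma rk_lt Y X : exposed Y X -> X != Y -> (rk x X < rk x Y)%N.
Proof.
move=> XY neXY; have sXY := exposed_sub XY.
have /properP [_ [i iY iX]] : X \proper Y by rewrite finset.properEneq neXY.
rewrite /rk ltn_neqAle dimvS ?hspanS // andbT.
apply: contraNN (exposed_notin_hspan XY iY iX) => /eqP E.
have -> : hspan x X = hspan x Y by apply/eqP; rewrite eqEdim hspanS //= E.
exact: mem_hspan.
Qed.

(** Tilt the hyperplane about [X] and [i]: some functional [h] vanishes there
but not on all of [Y], since the rank of [Y] exceeds that of [X] by more than
one. Add the largest multiple of [h] that keeps [Y] on the same side: this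
catches a new point, while the value at [i] does not change. *)
Lemma exposed_grow Y X i : exposed Y X -> i \in Y -> i \notin X ->
  ((rk x X).+1 < rk x Y)%N ->
  exists X', [/\ exposed Y X', X \proper X' & i \notin X'].
Proof.
move=> [g [gY XE]] iY iX rkXY.
pose U := (hspan x X + <[lift1 (x i)]>)%VS.
have [k kY kU] : exists2 k, k \in Y & lift1 (x k) \notin U.
  apply: contrapT => H.
  have /dimvS : (hspan x Y <= U)%VS.
    by apply: hspan_sub => k kY; apply: contrapT => /negP kU; apply: H; exists k.
  apply/negP; rewrite -ltnNge; apply: leq_ltn_trans rkXY.
  apply: (leq_trans (dimv_add_leqif _ _)).
  by rewrite dim_vline -/(rk x X); case: eqP => _; rewrite ?addn1 ?addn0.
have [h [hU hk]] : exists h, (forall u, u \in U -> dot h u = 0) /\ 0 < ev h (x k).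
  have [c [cU ck]] := separate_subspace kU.
  have [ck0|ck0] := ltP 0 (dot c (lift1 (x k))); first by exists c.
  exists (- c); split=> [u uU|]; first by rewrite dotNl cU ?oppr0.
  by rewrite evN oppr_gt0 lt_neqAle ck.
have hX l : l \in X -> ev h (x l) = 0.
  by move=> lX; apply: hU; apply: (subvP (addvSl _ _)); apply: mem_hspan.
have hi : ev h (x i) = 0.
  by apply: hU; apply: (subvP (addvSr _ _)); apply: memv_line.
pose pos l := (l \in Y) && (0 < ev h (x l)).
have posk : pos k by rewrite /pos kY.
pose t l := - ev g (x l) / ev h (x l).
have [k0 /andP[k0Y hk0] k0min] := arg_minP t posk.
have t0 : 0 <= t k0 by rewrite divr_ge0 ?(ltW hk0) // oppr_ge0 gY.
exists [set l in Y | ev (g + t k0 *: h) (x l) == 0]%SET; split.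
- exists (g + t k0 *: h); split => // l lY; rewrite evD evZ.
  have [hl|hl] := ltP 0 (ev h (x l)).
    have : t k0 <= t l by apply: k0min; rewrite /pos lY.
    by rewrite ler_pdivlMr // => H; lra.
  have := gY l lY; have := mulr_ge0_le0 t0 hl; lra.
- apply/properP; split.
    apply/fintype.subsetP => l lX; rewrite inE evD evZ hX // mulr0 addr0.
    by move: lX; rewrite XE inE.
  exists k0.
    have E : t k0 * ev h (x k0) = - ev g (x k0) by rewrite /t divfK ?gt_eqF.
    by rewrite inE k0Y evD evZ E addrN eqxx.
  by apply/negP => /hX E; move: hk0; rewrite E ltxx.
- rewrite inE iY evD evZ hi mulr0 addr0 /=.
  by move: iX; rewrite XE inE iY.
Qed.

(** Iterate [exposed_grow]. Consequently a face is the intersection of the facets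
that contain it. *)
Lemma exposed_in_facet Y X i : exposed Y X -> i \in Y -> i \notin X ->
  exists X', [/\ exposed Y X', X \subset X', i \notin X' & rk x Y = (rk x X').+1].
Proof.
move: {2}(rk x Y - rk x X)%N (leqnn (rk x Y - rk x X)%N) => N.
elim: N X => [|N IH] X leN eX iY iX.
  have : (rk x X < rk x Y)%N.
    by apply: rk_lt => //; apply: contraNneq iX => ->.
  by move: leN; rewrite leqn0 subn_eq0 leqNgt => /negPf ->.
have rX : (rk x X < rk x Y)%N.
  by apply: rk_lt => //; apply: contraNneq iX => ->.
have [rXY|rXY] := ltnP (rk x X).+1 (rk x Y); last first.
  by exists X; split => //; apply/eqP; rewrite eqn_leq rX rXY.
have [X1 [eX1 /properP [sX1 [k kX1 kX]] iX1]] := exposed_grow eX iY iX rXY.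
have r1 : (rk x X < rk x X1)%N.
  apply: rk_lt; first by apply: exposed_restrict eX => //; apply: exposed_sub.
  by apply: contraNneq kX => ->.
have [X' [eX' sX' iX' rX']] : exists X',
    [/\ exposed Y X', X1 \subset X', i \notin X' & rk x Y = (rk x X').+1].
  by apply: IH => //; move: leN r1 rX rXY; lia.
by exists X'; split => //; apply: fintype.subset_trans sX'.
Qed.

Lemma rkU1 X i : (rk x (i |: X)%SET <= (rk x X).+1)%N.
Proof.
apply: (@leq_trans (\dim (hspan x X + <[lift1 (x i)]>)%VS)).
  apply: dimvS; apply: hspan_sub => k; rewrite !inE => /orP[/eqP ->|kX].
    by apply: (subvP (addvSr _ _)); apply: memv_line.
  by apply: (subvP (addvSl _ _)); apply: mem_hspan.
apply: (leq_trans (dimv_add_leqif _ _)).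
by rewrite dim_vline -/(rk x X); case: eqP => _; rewrite ?addn1 ?addn0.
Qed.

Lemma rkD1 X i : i \in X -> (rk x X <= (rk x (X :\ i)%SET).+1)%N.
Proof. by move=> iX; have := rkU1 (X :\ i)%SET i; rewrite finset.setD1K. Qed.

Lemma rk_card X : (rk x X <= #|X|)%N.
Proof.
move: {2}#|X| (erefl #|X|) => N; elim: N X => [|N IH] X XN.
  by move: XN => /cards0_eq ->; rewrite rk0.
have [i iX] : exists i, i \in X by apply/set0Pn; rewrite -cards_eq0 XN.
apply: leq_trans (rkD1 iX) _; rewrite (cardsD1 i X) iX ltnS; apply: IH.
by move: XN; rewrite (cardsD1 i X) iX => -[].
Qed.

Definition indep X := rk x X == #|X|.

Lemma indepD1 X i : i \in X -> indep X -> indep (X :\ i)%SET.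
Proof.
move=> iX /eqP E; rewrite /indep eqn_leq rk_card -ltnS.
have := rkD1 iX; rewrite E (cardsD1 i X) iX; lia.
Qed.

(** In a simplex every set of vertices spans a face; one vertex is removed at a
time. *)
Lemma indepS_exposed X Z : indep X -> Z \subset X -> indep Z /\ exposed X Z.
Proof.
move: {2}#|X| (erefl #|X|) => N; elim: N X => [|N IH] X XN iX ZX.
  move: XN => /cards0_eq X0; move: ZX; rewrite X0 finset.subset0 => /eqP ->.
  by rewrite -X0; split => //; exact: exposed_refl.
have [->|neZX] := eqVneq Z X; first by split => //; exact: exposed_refl.
have /properP [_ [i iXi iZ]] : Z \proper X by rewrite finset.properEneq neZX.
have cX : #|(X :\ i)%SET| = N by move: XN; rewrite (cardsD1 i X) iXi => -[].
have ZXi : Z \subset (X :\ i)%SET by rewrite finset.subsetD1 ZX.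
have [iiZ eZ] := IH _ cX (indepD1 iXi iX) ZXi; split => //.
apply: exposed_trans eZ.
have ni : lift1 (x i) \notin hspan x (X :\ i)%SET.
  apply/negP => H; have /dimvS : (hspan x X <= hspan x (X :\ i)%SET)%VS.
    by apply: hspan_sub => k kX; have [->//|ki] := eqVneq k i; apply: mem_hspan; rewrite !inE ki.
  rewrite -/(rk x X) (eqP iX) => /leq_trans /(_ (rk_card _)).
  by rewrite cX XN ltnn.
have [h [hU hk]] : exists h, (forall u, u \in hspan x (X :\ i)%SET -> dot h u = 0) /\ ev h (x i) < 0.
  have [c [cU ck]] := separate_subspace ni.
  have [ck0|ck0] := ltP (dot c (lift1 (x i))) 0; first by exists c.
  exists (- c); split=> [u uU|]; first by rewrite dotNl cU ?oppr0.
  by rewrite evN oppr_lt0 lt_neqAle eq_sym ck.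
have hX l : l \in (X :\ i)%SET -> ev h (x l) = 0 by move=> lX; apply: hU; apply: mem_hspan.
exists h; split=> [l lX|].
  have [->|li] := eqVneq l i; first exact: ltW.
  by rewrite hX // !inE li.
apply/setP => l; rewrite finset.in_setD1 inE; have [->|li] /= := eqVneq l i.
  by rewrite (lt_eqF hk) andbF.
by have [lX|//] := boolP (l \in X); rewrite hX ?eqxx // !inE li.
Qed.

Lemma indepS X Z : indep X -> Z \subset X -> indep Z.
Proof. by move=> iX ZX; case: (indepS_exposed iX ZX). Qed.

End Exposed.

(** * Points in convex position *)

Lemma card_fset_set_image (J : finType) (U : choiceType) (f : J -> U)
    (A : {set J}) (S : set U) :
  {in A &, injective f} -> (forall t, S t <-> exists2 a, a \in A & t = f a) ->
  #|` fset_set S| = #|A|.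
Proof.
move=> f_inj SP.
have SE : S = [set t | t \in [seq f a | a <- enum A]].
  apply/seteqP; split=> t.
    by move=> /SP [a aA ->]; apply: map_f; rewrite mem_enum.
  by move=> /mapP [a]; rewrite mem_enum => aA ->; apply/SP; exists a.
have -> : fset_set S = seq_fset tt [seq f a | a <- enum A].
  rewrite SE; apply/fsetP => t.
  by rewrite in_fset_set ?seq_fsetE ?inE; [apply/idP/idP; rewrite inE| exact: finite_seq].
rewrite size_seq_fset undup_id ?size_map ?cardE //.
rewrite map_inj_in_uniq ?enum_uniq // => a a'; rewrite !mem_enum; exact: f_inj.
Qed.

Section ConvexPosition.
Variables (R : realType) (m : nat) (I : finType).
Local Notation V := 'rV[R]_m.
Variable x : I -> V.
Implicit Types (X Y Z : {set I}).

(** Stated through exposedness, so that restricting to a face is immediate. *)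
Definition convex_position := forall i, exposed x [set: I]%SET [set i]%SET.

Lemma conv_hull (A : set V) X : A = x @` [set` X] -> conv A = hull x X.
Proof. by move=> ->. Qed.

Lemma indepU1 X i : indep x X -> lift1 (x i) \notin hspan x X -> indep x (i |: X)%SET.
Proof.
move=> iX niX; have iX' : i \notin X by apply: contra niX; apply: mem_hspan.
rewrite /indep eqn_leq rk_card cardsU1 iX' add1n -(eqP iX).
have ss : X \subset (i |: X)%SET by apply: finset.subsetUr.
rewrite /rk ltn_neqAle dimvS ?hspanS // andbT.
apply: contraNN niX => /eqP E.
have -> : hspan x X = hspan x (i |: X)%SET by apply/eqP; rewrite eqEdim hspanS //= E.
by apply: mem_hspan; rewrite !inE eqxx.
Qed.

Lemma indep_aff X i : indep x X -> i \in X -> lift1 (x i) \notin hspan x (X :\ i)%SET.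
Proof.
move=> iX iiX; have [_ eX] := indepS_exposed iX (finset.subsetDl X [set i]).
by apply: exposed_notin_hspan eX iiX _; rewrite !inE eqxx.
Qed.

Lemma indep_of_aff X :
  (forall i, i \in X -> lift1 (x i) \notin hspan x (X :\ i)%SET) -> indep x X.
Proof.
move=> H; have : forall Z, Z \subset X -> indep x Z; last by apply.
move=> Z; move: {2}#|Z| (erefl #|Z|) => N; elim: N Z => [|N IH] Z ZN ZX.
  by move: ZN => /cards0_eq ->; rewrite /indep rk0 cards0.
have [i iZ] : exists i, i \in Z by apply/set0Pn; rewrite -cards_eq0 ZN.
rewrite -(finset.setD1K iZ); apply: indepU1.
  apply: IH; first by move: ZN; rewrite (cardsD1 i Z) iZ => -[].
  by apply: fintype.subset_trans ZX; exact: finset.subsetDl.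
have iX := fintype.subsetP ZX i iZ.
apply: contra (H i iX); apply: (subvP (hspanS x _)).
exact: finset.setSD.
Qed.

Hypothesis cpx : convex_position.

Lemma hull_mem X i : hull x X (x i) <-> i \in X.
Proof.
split; last exact: mem_hull.
have [g [gT E]] := cpx i => Xi.
have gX k : k \in X -> ev g (x k) <= 0 by move=> _; apply: gT; rewrite inE.
have gi : ev g (x i) = 0.
  by have := set11 i; rewrite E !inE => /eqP.
have : hull x [set k in X | ev g (x k) == 0]%SET (x i) by rewrite -hull_eq0.
apply: contraPT => iX.
have -> : [set k in X | ev g (x k) == 0]%SET = finset.set0.
  apply/setP => k; rewrite !inE; apply/negP => /andP[kX gk].
  have : k \in [set i]%SET by rewrite E !inE.
  by rewrite inE => /eqP ki; move: iX; rewrite -ki kX.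
by rewrite hull0.
Qed.

Lemma hull_inj X Y : hull x X = hull x Y -> X = Y.
Proof.
move=> E; apply/setP => i; apply/idP/idP => /hull_mem; first by rewrite E => /hull_mem.
by rewrite -E => /hull_mem.
Qed.

Lemma point_inj : injective x.
Proof.
move=> i j E; have : hull x [set j]%SET (x i) by rewrite E; apply: mem_hull; rewrite inE.
by move=> /hull_mem; rewrite inE => /eqP.
Qed.

Lemma vertex_hull Y v : vertex (hull x Y) v <-> exists2 i, i \in Y & v = x i.
Proof.
split=> [/face_hullP [X eX E]|[i iY ->]].
  have [X0|[i iX]] := finset.set_0Vmem X.
    by exfalso; have : [set v] v by []; rewrite E X0 hull0.
  exists i; first by apply: (fintype.subsetP (exposed_sub eX)).
  by have := mem_hull x iX; rewrite -E => ->.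
apply/face_hullP; exists [set i]%SET; last by rewrite hull1.
by apply: exposed_restrict (cpx i); rewrite ?finset.sub1set // finset.subsetT.
Qed.

Lemma vertex_array_hull (s : seq I) X : uniq s -> s =i X ->
  vertex_array [seq x i | i <- s] (hull x X).
Proof.
move=> us sX; split; first exact: polytope_hull.
  by rewrite map_inj_uniq //; exact: point_inj.
apply/seteqP; split=> v.
  by move=> /mapP [i]; rewrite sX => iX ->; apply/vertex_hull; exists i.
by move=> /vertex_hull [i iX ->]; apply: map_f; rewrite sX.
Qed.

Lemma faces_hull Y (k : nat) F : faces (hull x Y) (k%:Z - 1) F <->
  exists X, [/\ exposed x Y X, rk x X = k & F = hull x X].
Proof.
split=> [[/face_hullP [X eX ->] /has_dim_hull E]|[X [eX <- ->]]].
  by exists X; split => //; lia.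
by split; [apply/face_hullP; exists X | apply/has_dim_hull].
Qed.

Lemma faces_hull_mem Y Z (k : nat) :
  faces (hull x Y) (k%:Z - 1) (hull x Z) <-> exposed x Y Z /\ rk x Z = k.
Proof.
split=> [/faces_hull [X [eX rX /hull_inj ->]] //|[eZ rZ]].
by apply/faces_hull; exists Z.
Qed.

Lemma fnum_hull Y (k : nat) (A : {set {set I}}) :
  (forall X, X \in A <-> exposed x Y X /\ rk x X = k) ->
  fnum (hull x Y) (k%:Z - 1) = #|A|.
Proof.
move=> AP; apply: (@card_fset_set_image _ _ (hull x)) => [X X' _ _ /hull_inj //|F].
split=> [/faces_hull [X [eX rX ->]]|[X /AP [eX rX] ->]].
  by exists X => //; apply/AP.
by apply/faces_hull; exists X.
Qed.

Lemma simplex_hull X : indep x X -> simplex (#|X|%:Z - 1) (hull x X).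
Proof.
move=> iX; have sE : [set` [seq x i | i <- enum X]] = x @` [set` X].
  apply/seteqP; split=> v.
    by move=> /mapP [i]; rewrite mem_enum => iiX ->; exists i.
  by move=> [i iiX <-]; apply: map_f; rewrite mem_enum.
exists [seq x i | i <- enum X]; split.
- split; first by rewrite map_inj_uniq ?enum_uniq //; exact: point_inj.
  move=> _ /mapP [i iiX ->]; rewrite mem_enum in iiX; rewrite sE => H.
  have /negP := indep_aff iX iiX; apply; apply/aff_hull; apply: affS H => _ [[k kX <-] ki].
  apply: mem_hull; rewrite !inE; move: kX => /= -> ; rewrite andbT.
  by apply/eqP => E; apply: ki; rewrite E.
- by rewrite size_map -cardE; lia.
- by rewrite sE.
Qed.

End ConvexPosition.

(** In a generating set of least cardinality no point lies in the hull of the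
others, so Farkas' lemma in homogeneous coordinates exposes each point. *)
Lemma polytope_vertices (R : realType) (m : nat) (P : set 'rV[R]_m) :
  polytope P -> P = conv [set v | vertex P v].
Proof.
move=> [s Ps]; pose x (i : 'I_(size s)) := s`_i.
pose good (X : {set 'I_(size s)}) := `[< hull x X = P >].
have PT : good [set: 'I_(size s)]%SET.
  apply/asboolP; rewrite Ps; congr conv; apply/seteqP; split=> [_ [i _ <-]|v].
    exact: mem_nth.
  move=> vs; have iv : (index v s < size s)%N by rewrite index_mem.
  by exists (Ordinal iv); rewrite /= ?inE // /x nth_index.
have [X /asboolP XP Xmin] := arg_minnP (fun X : {set 'I_(size s)} => #|X|) PT.
have eX i : i \in X -> exposed x X [set i]%SET.
  move=> iX; have [[w [w0 E]]|[g [gX gi]]] :=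
      farkas (X :\ i)%SET (fun k => lift1 (x k)) (lift1 (x i)).
    pose w' k := if k \in (X :\ i)%SET then w k else 0.
    have {}E : lift1 (x i) = \sum_k w' k *: lift1 (x k).
      rewrite E big_mkcond /=; apply: eq_bigr => k _; rewrite /w'.
      by case: ifP => // _; rewrite scale0r.
    move: E; rewrite lift1_sum => /homog_inj [xi w1].
    have xiX : hull x (X :\ i)%SET (x i).
      apply/hullP; exists w'; split => //.
        by move=> k; rewrite /w'; case: ifP.
      by move=> k /negPf kX; rewrite /w' kX.
    have HP : hull x (X :\ i)%SET = P.
      rewrite -XP; apply/seteqP; split; first by apply: hullS; exact: finset.subsetDl.
      apply: conv_sub_hull => _ [k kX <-]; have [->//|ki] := eqVneq k i.
      by apply: mem_hull; rewrite !inE ki.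
    have := Xmin (X :\ i)%SET; move=> /(_ (asboolT HP)).
    by rewrite (cardsD1 i X) iX ltnn.
  have [c [b gE]] := ev_affine g.
  have [h hE] := affine_ev (- c) (- (dot c (x i))).
  exists h.
  have hk k : k \in X -> k != i -> ev h (x k) < 0.
    move=> kX ki; have := gX k; rewrite !inE ki => /(_ kX); move: gi.
    by rewrite -!/(ev g _) !gE hE dotNl; lra.
  have hi : ev h (x i) = 0 by rewrite hE dotNl; lra.
  split=> [k kX|]; first by have [->|/(hk k kX)/ltW//] := eqVneq k i; rewrite hi.
  apply/setP => k; rewrite !inE; have [->|ki] := eqVneq k i; first by rewrite iX hi eqxx.
  by have [kX|//] := boolP (k \in X); rewrite /= lt_eqF ?hk.
rewrite -XP; congr conv; apply/seteqP; split=> v.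
  move=> [i iX <-]; apply/face_hullP; exists [set i]%SET; first exact: eX.
  by rewrite hull1.
move=> /face_hullP [Y eY E].
have [Y0|[i iY]] := finset.set_0Vmem Y.
  by exfalso; have : [set v] v by []; rewrite E Y0 hull0.
exists i; first exact: (fintype.subsetP (exposed_sub eY)).
by have := mem_hull x iY; rewrite -E => ->.
Qed.

(** * Vertex arrays, and braxtopes in terms of index sets *)

Section VertexArrays.
Variables (R : realType) (m : nat).
Local Notation V := 'rV[R]_m.
Implicit Types (xs : seq V) (P : set V).

Definition vtx xs N : 'I_N -> V := fun i => nth 0 xs i.

Lemma vtx_enum xs N : size xs = N -> xs = [seq vtx xs i | i <- enum 'I_N].
Proof.
move=> sN; apply: (@eq_from_nth _ 0); first by rewrite size_map size_enum_ord.
move=> i; rewrite sN => iN.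
rewrite (nth_map (Ordinal iN)) ?size_enum_ord // /vtx.
by rewrite nth_enum_ord.
Qed.

Lemma hull_vtx xs N : size xs = N -> hull (vtx xs (N:=N)) [set: 'I_N]%SET = conv [set` xs].
Proof.
move=> sN; congr conv; apply/seteqP; split=> [_ [i _ <-]|v vs].
  by rewrite /= /vtx mem_nth // sN.
have iv : (index v xs < N)%N by rewrite -sN index_mem.
by exists (Ordinal iv); rewrite /= ?inE // /vtx nth_index.
Qed.

Lemma vertex_arrayP xs N P : size xs = N -> vertex_array xs P <->
  convex_position (vtx xs (N:=N)) /\ P = hull (vtx xs (N:=N)) [set: 'I_N]%SET.
Proof.
move=> sN; split=> [[pP us xsP]|[cpx ->]]; last first.
  rewrite {1}(vtx_enum sN); apply: vertex_array_hull => //; first exact: enum_uniq.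
  by move=> i; rewrite mem_enum !inE.
have PE : P = hull (vtx xs (N:=N)) [set: 'I_N]%SET.
  by rewrite hull_vtx // xsP; exact: polytope_vertices.
split => // i.
have iN : (i < size xs)%N by rewrite sN.
have /face_hullP [X eX E] : face (hull (vtx xs (N:=N)) [set: 'I_N]%SET) [set vtx xs i].
  rewrite -PE; have : [set` xs] (vtx xs i) by rewrite /= mem_nth.
  by rewrite xsP.
suff -> : [set i]%SET = X by [].
have uniqi k : k \in X -> k = i.
  move=> /(mem_hull (vtx xs (N:=N))); rewrite -E /= /vtx => /eqP.
  by rewrite nth_uniq ?sN // => /eqP /val_inj.
have [X0|[k kX]] := finset.set_0Vmem X.
  by exfalso; have : [set vtx xs i] (vtx xs i) by []; rewrite E X0 hull0.
apply/setP => l; rewrite inE; apply/eqP/idP => [->|/uniqi //].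
by rewrite -(uniqi k kX).
Qed.

Lemma induced_hull xs N X : size xs = N -> convex_position (vtx xs (N:=N)) ->
  induced xs (hull (vtx xs (N:=N)) X) = [seq vtx xs i | i <- enum X].
Proof.
move=> sN; rewrite /induced; set x := vtx xs (N:=N) => cpx.
rewrite (vtx_enum sN) -/x filter_map; congr map.
rewrite [RHS]/enum_mem -enumT; apply: eq_filter => i /=.
by apply/idP/idP; rewrite inE => /hull_mem; apply.
Qed.

Section Indices.
Variables (n d : nat).

Definition Tset i : {set 'I_n.+1} := [set k : 'I_n.+1 | (i <= k < i + d)%N]%SET.

(** The last alternative restores [n] when [j = n]: there the convention
[x_t = x_n] for [t >= n] brings back the omitted index. For [2 <= j] the
convention at the other end only adds the index 0, which is present anyway. *)
Definition Eset j : {set 'I_n.+1} := [set k : 'I_n.+1 | (k == 0 :> nat) ||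
  [&& j <= k + (d - 2), k <= j + (d - 2) & (k != j :> nat) || (j == n)]]%N%SET.

Definition brax_facet (X : {set 'I_n.+1}) : Prop :=
  (exists2 i, i + d <= n.+1 & X = Tset i)%N \/
  (exists2 j, 2 <= j <= n & X = Eset j)%N.

End Indices.

Lemma pt_nat xs n (k : nat) : size xs = n.+1 -> (k <= n)%N -> pt xs k%:Z = nth 0 xs k.
Proof. by move=> sn kn; rewrite /pt sn /= (minn_idPl kn). Qed.

Lemma pt_large xs n (k : nat) : size xs = n.+1 -> (n <= k)%N -> pt xs k%:Z = nth 0 xs n.
Proof. by move=> sn kn; rewrite /pt sn /= (minn_idPr kn). Qed.

Lemma brax_T_hull xs n d (i : nat) : size xs = n.+1 -> (i + d <= n.+1)%N ->
  brax_T d%:Z xs i%:Z = hull (vtx xs (N:=n.+1)) (Tset n d i).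
Proof.
move=> sn idn; apply: conv_hull; apply/seteqP; split=> [_ [t /= tid <-]|_ [k /= kT <-]].
  case: t tid => k tid; last by lia.
  have kn : (k < n.+1)%N by lia.
  exists (Ordinal kn); last by rewrite (pt_nat sn) //; lia.
  by rewrite /= inE /=; lia.
exists k%:Z; first by move: kT; rewrite inE /=; lia.
by rewrite (pt_nat sn) //; have := ltn_ord k; lia.
Qed.

Lemma brax_E_hull xs n d (j : nat) : size xs = n.+1 -> (3 <= d)%N -> (2 <= j <= n)%N ->
  brax_E d%:Z xs j%:Z = hull (vtx xs (N:=n.+1)) (Eset n d j).
Proof.
move=> sn d3 jn; apply: conv_hull; apply/seteqP; split.
  move=> _ /= [->|[t /= [tj tj'] <-]].
    by exists ord0; [rewrite /= inE | rewrite /vtx /pt /= min0n].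
  case: t tj tj' => k tj tj'; last by exists ord0; rewrite /= ?inE.
  have [kn|kn] := ltnP k n.
    have kn' : (k < n.+1)%N by lia.
    exists (Ordinal kn'); last by rewrite (pt_nat sn) //; lia.
    by rewrite /= inE /=; apply/orP; right; lia.
  exists ord_max; last by rewrite (pt_large sn).
  by rewrite /= inE /=; apply/orP; right; lia.
move=> _ [k /= kE <-].
have kn := ltn_ord k.
move: kE; rewrite inE => /orP[k0|/and3P[k1 k2 k3]].
  by left; rewrite /vtx (eqP k0) /pt /= min0n.
right; have [kj|kj] := eqVneq (k : nat) j; last first.
  by exists k%:Z; [rewrite /=; split; lia | rewrite (pt_nat sn) //; lia].
exists n.+1%:Z; first by rewrite /=; split; lia.
by rewrite (pt_large sn) // /vtx; congr nth; lia.
Qed.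

(** An index truncated to 0 is present anyway, and one truncated to [n] matters only
for [E_n]; so the windows of integers become sets of natural numbers. *)
Lemma braxtopeP xs n d P : size xs = n.+1 -> (3 <= d)%N ->
  braxtope d%:Z xs P <->
  [/\ convex_position (vtx xs (N:=n.+1)),
      P = hull (vtx xs (N:=n.+1)) [set: 'I_n.+1]%SET,
      rk (vtx xs (N:=n.+1)) [set: 'I_n.+1]%SET = d.+1, (d <= n)%N &
      forall X, exposed (vtx xs (N:=n.+1)) [set: 'I_n.+1]%SET X /\
         rk (vtx xs (N:=n.+1)) X = d <-> brax_facet d X].
Proof.
move=> sn d3; set x := vtx xs (N:=n.+1).
have li : last_index xs = n%:Z by rewrite /last_index sn; lia.
have d2 : (d%:Z <= 2) = false by apply/negP; lia.
have RHSE F : ([set brax_T d%:Z xs i | i in [set i : int | 0 <= i <= n%:Z - d%:Z + 1]] `|`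
      [set brax_E d%:Z xs j | j in [set j : int | 2 <= j <= n%:Z]]) F <->
   exists2 X, brax_facet d X & F = hull x X.
  split.
    case=> [[t /= tn <-]|[t /= tn <-]]; case: t tn => k kn; try by lia.
      have kdn : (k + d <= n.+1)%N by lia.
      by exists (Tset n d k); [left; exists k | exact: brax_T_hull].
    have kn' : (2 <= k <= n)%N by lia.
    by exists (Eset n d k); [right; exists k | exact: brax_E_hull].
  case=> X [[i idn ->]|[j jn ->]] ->.
    by left; exists i%:Z; [rewrite /=; lia | exact: brax_T_hull].
  by right; exists j%:Z; [rewrite /=; lia | exact: brax_E_hull].
rewrite /braxtope d2 (vertex_arrayP P sn) -/x li.
split=> [[[cpx PE] [dP dn FE]]|[cpx PE rx dn FE]].
  split => //; first by move: dP; rewrite PE => /has_dim_hull; lia.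
  move=> X; split=> [[eX rX]|bX].
    have : facets d%:Z P (hull x X) by rewrite PE /facets; apply/faces_hull; exists X.
    by rewrite FE => /RHSE [Y bY /(hull_inj cpx) ->].
  have : facets d%:Z P (hull x X) by rewrite FE; apply/RHSE; exists X.
  by rewrite PE /facets => /faces_hull [Y [eY rY /(hull_inj cpx) ->]].
split => //; split; [by rewrite PE; apply/has_dim_hull; lia | by lia|].
rewrite /facets; apply/seteqP; split=> F.
  rewrite PE => /faces_hull [X [eX rX ->]].
  by apply/RHSE; exists X => //; apply/FE.
move=> /RHSE [X /FE [eX rX] ->].
by rewrite PE; apply/faces_hull; exists X.
Qed.

(** With [n + 1] vertices in dimension [n], the sets [T_0], [T_1], [E_n] and [E_j]
omit the vertices [n], 0, 1 and [j] respectively. *)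
Lemma brax_facet_simplex n (X : {set 'I_n.+1}) : (3 <= n)%N ->
  brax_facet n X <-> #|X| = n.
Proof.
move=> n3.
have cC (k : 'I_n.+1) : #|[set~ k]%SET| = n by rewrite cardsC1 card_ord.
split=> [[[i idn ->]|[j jn ->]]|cX].
- have [i0|i1] : i = 0%N \/ i = 1%N by lia.
    suff -> : Tset n n i = [set~ ord_max]%SET by rewrite cC.
    by apply/setP => k; rewrite !inE -val_eqE /=; have := ltn_ord k; lia.
  suff -> : Tset n n i = [set~ ord0]%SET by rewrite cC.
  by apply/setP => k; rewrite !inE -val_eqE /=; have := ltn_ord k; lia.
- have [jn'|jn'] := eqVneq j n.
    have h1 : (1 < n.+1)%N by lia.
    suff -> : Eset n n j = [set~ (Ordinal h1)]%SET by rewrite cC.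
    by apply/setP => k; rewrite !inE -val_eqE /=; have := ltn_ord k; lia.
  have h1 : (j < n.+1)%N by lia.
  suff -> : Eset n n j = [set~ (Ordinal h1)]%SET by rewrite cC.
  by apply/setP => k; rewrite !inE -val_eqE /=; have := ltn_ord k; lia.
have /eqP /cards1P [k kE] : #|(~: X)%SET| = 1%N.
  by have := cardsC X; rewrite cX card_ord; lia.
have XE l : (l \in X) = (l != k :> nat).
  by have /setP /(_ l) := kE; rewrite !inE -val_eqE => /= <-; rewrite negbK.
have kn := ltn_ord k.
have [k0|k0] := eqVneq (k : nat) 0%N.
  left; exists 1%N; first by lia.
  by apply/setP => l; rewrite XE inE; have := ltn_ord l; lia.
have [k1|k1] := eqVneq (k : nat) n.
  left; exists 0%N; first by lia.
  by apply/setP => l; rewrite XE inE; have := ltn_ord l; lia.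
have [k2|k2] := eqVneq (k : nat) 1%N.
  right; exists n; first by lia.
  by apply/setP => l; rewrite XE inE; have := ltn_ord l; lia.
right; exists k; first by lia.
by apply/setP => l; rewrite XE inE; have := ltn_ord l; lia.
Qed.

End VertexArrays.

(** In dimension at least 3 all sets of vertices are faces, and those of the right
rank omit one vertex, so that [brax_facet_simplex] applies. *)
Lemma simplex_braxtope (R : realType) (m : nat) (I : finType) (x : I -> 'rV[R]_m)
    (s : seq I) (X : {set I}) :
  convex_position x -> indep x X -> uniq s -> s =i X ->
  braxtope (#|X|%:Z - 1) [seq x i | i <- s] (hull x X).
Proof.
move=> cpx iX us sX.
have va : vertex_array [seq x i | i <- s] (hull x X) by exact: vertex_array_hull.
have sz : size s = #|X| by rewrite -(card_uniqP us); apply: eq_card.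
have [X3|X3] := leqP #|X| 3.
  split => //; have -> : (#|X|%:Z - 1 <= 2) by lia.
  exact: simplex_hull.
case E : #|X| X3 => [//|n] n3.
have -> : n.+1%:Z - 1 = n%:Z by lia.
have sn : size [seq x i | i <- s] = n.+1 by rewrite size_map sz.
apply/(braxtopeP _ sn); first by lia.
have [cpy PE] := (vertex_arrayP _ sn).1 va.
set y := vtx _ (N := n.+1) in cpy PE *.
have ry : rk y [set: 'I_n.+1]%SET = n.+1.
  have : has_dim (hull x X) n%:Z by apply/has_dim_hull; rewrite (eqP iX) E; lia.
  by rewrite PE => /has_dim_hull; lia.
have iy : indep y [set: 'I_n.+1]%SET by rewrite /indep ry cardsT card_ord.
split => // Z; rewrite brax_facet_simplex; last by lia.
have [iZ eZ] := indepS_exposed iy (finset.subsetT Z).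
by rewrite (eqP iZ); split=> [[]|].
Qed.

(** * The faces of a braxtope *)

Lemma card_window n s l : (s + l <= n.+1)%N ->
  #|[set k : 'I_n.+1 | (s <= k < s + l)%N]%SET| = l.
Proof.
move=> sl; have -> : [set k : 'I_n.+1 | (s <= k < s + l)%N]%SET
    = [set inord (s + k)%N | k : 'I_l]%SET.
  apply/setP => k; rewrite inE; apply/idP/imsetP => [/andP[k1 k2]|[i _ ->]].
    have kl : (k - s < l)%N by lia.
    exists (Ordinal kl) => //; apply: val_inj; rewrite /= inordK; lia.
  by rewrite inordK; have := ltn_ord i; lia.
rewrite card_imset ?card_ord // => i k /(congr1 val) /=.
have := ltn_ord i; have := ltn_ord k => ? ?.
by rewrite !inordK; try lia; move=> /addnI /val_inj.
Qed.

Section Combinatorics.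
Variables (n d : nat).
Hypotheses (d3 : (3 <= d)%N) (dn : (d <= n)%N).
Implicit Types (X Y F J : {set 'I_n.+1}).
Local Open Scope nat_scope.

(** The vertex [x_0] with [d - 2] consecutive vertices: what [E_t] and
[E_(t+d-1)] have in common. *)
Definition apex_window t : {set 'I_n.+1} :=
  [set k : 'I_n.+1 | (k == 0 :> nat) || (t < k) && (k.+1 < t + d)]%SET.

Definition short X : Prop :=
  [\/ exists2 i, i + d <= n.+1 & X \subset Tset n d i, X \subset Eset n d n |
      exists2 t, (2 <= t) && (t + d <= n) & X \subset apex_window t].

(** The intersection of the [E_j], [j] in [J], when [J] lies in [2 .. n - 1]. *)
Definition gapped J : {set 'I_n.+1} := [set k : 'I_n.+1 | (k == 0 :> nat) ||
  [forall t in J, [&& k != t, t < k + d.-1 & k < t + d.-1]]]%SET.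

Definition clustered J : Prop :=
  (forall t, t \in J -> 2 <= t < n) /\
  (forall s t, s \in J -> t \in J -> s <= t + (d - 3)).

Lemma in_gapped J (k : 'I_n.+1) : reflect
  (k = 0 :> nat \/ forall t : 'I_n.+1, t \in J -> [/\ k <> t :> nat, t < k + d.-1 & k < t + d.-1])
  (k \in gapped J).
Proof.
rewrite inE; apply: (iffP orP) => -[/eqP k0|H]; try by left.
- right=> t tJ; have /forall_inP /(_ t tJ) /and3P [k1 k2 k3] := H; split => //.
  by move=> /val_inj /eqP; apply/negP.
- right; apply/forall_inP => t /H [k1 k2 k3]; apply/and3P; split => //.
by apply/negP => /eqP E; apply: k1; rewrite E.
Qed.

Lemma clusteredS J J' : J' \subset J -> clustered J -> clustered J'.
Proof.
move=> /fintype.subsetP sJ [J1 J2]; split=> [t /sJ /J1 //|s t /sJ sJ' /sJ tJ'].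
exact: J2.
Qed.

Lemma clustered0 : clustered finset.set0.
Proof. by split=> [t|s t]; rewrite inE. Qed.

Lemma gapped0 : gapped finset.set0 = [set: 'I_n.+1]%SET.
Proof. by apply/setP => k; rewrite [RHS]inE; apply/in_gapped; right=> t; rewrite inE. Qed.

Lemma gapped1 (j : 'I_n.+1) : 2 <= j < n -> gapped [set j]%SET = Eset n d j.
Proof.
move=> jn; apply/setP => k; rewrite [RHS]inE; apply/idP/idP => [/in_gapped|].
  case=> [->//|H]; have [|k1 k2 k3] := H j; first by rewrite inE.
  by apply/orP; right; lia.
move=> H; apply/in_gapped; case/orP: H => [/eqP ->|H]; first by left.
by right=> t; rewrite inE => /eqP ->; split; lia.
Qed.

Lemma gappedU J J' : gapped (J :|: J') = gapped J :&: gapped J'.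
Proof.
apply/setP => k; rewrite !inE; have [//|k0] := eqVneq (k : nat) 0 => /=.
apply/forall_inP/andP => [H|[/forall_inP H1 /forall_inP H2] t].
  by split; apply/forall_inP => t tJ; apply: H; rewrite inE tJ ?orbT.
by rewrite inE => /orP[/H1|/H2].
Qed.

Lemma shortS X Y : X \subset Y -> short Y -> short X.
Proof.
move=> XY [[i id YT]|YE|[t tn YA]].
- by constructor 1; exists i => //; apply: fintype.subset_trans YT.
- by constructor 2; apply: fintype.subset_trans YE.
- by constructor 3; exists t => //; apply: fintype.subset_trans YA.
Qed.

(** The sets [E_s] and [E_t] with [s] and [t] far apart meet in a short set: the
common part of the two windows has at most [d - 2] consecutive elements once
[s] and [t] are left out. *)
Lemma short_far X (s t : nat) : 2 <= s -> t < n -> s + (d - 2) <= t ->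
  (forall k : 'I_n.+1, k \in X -> k = 0 :> nat \/
     [/\ k <> s :> nat, k <> t :> nat, t < k + d.-1 & k < s + d.-1]) ->
  short X.
Proof.
move=> s2 tn st H; have [sd|sd] := leqP (s + d) n.
  constructor 3; exists s; first by rewrite s2 sd.
  apply/fintype.subsetP => k /H kX; rewrite inE; case: kX => [->//|[k1 k2 k3 k4]].
  by apply/orP; right; lia.
constructor 2; apply/fintype.subsetP => k /H kX; rewrite inE; have := ltn_ord k.
case: kX => [->//|[k1 k2 k3 k4]] ?.
by apply/orP; right; lia.
Qed.

Definition shape X : Prop := short X \/ exists2 J, clustered J & X = gapped J.

(** The case of [gapped J] and [E_j]: if [j] is close to all of [J], then [J] with
[j] added is again clustered; if not, two indices are far apart and the
intersection is short. *)
Lemma shapeI_facet X F : shape X -> brax_facet d F -> shape (X :&: F).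
Proof.
case=> [sX _|[J cJ ->]]; first by left; apply: shortS sX; exact: finset.subsetIl.
case=> [[i id ->]|[j jn ->]].
  by left; constructor 1; exists i => //; exact: finset.subsetIr.
have [->|jn'] := eqVneq j n.
  by left; constructor 2; exact: finset.subsetIr.
have jN : j < n.+1 by lia.
set j' := Ordinal jN; have j2 : 2 <= j' < n by rewrite /=; lia.
have -> : Eset n d j = gapped [set j']%SET by rewrite gapped1.
have [cJ'|ncJ'] := pselect (forall s, s \in J -> s <= j' + (d - 3) /\ j' <= s + (d - 3)).
  right; exists (J :|: [set j']%SET); last by rewrite gappedU.
  have [J1 J2] := cJ; split=> [t|s t]; rewrite !inE.
    by move=> /orP[/J1//|/eqP ->].
  move=> /orP[sJ|/eqP ->] /orP[tJ|/eqP ->]; first exact: J2.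
  - by case: (cJ' s sJ).
  - by case: (cJ' t tJ).
  - exact: leq_addr.
have [s [sJ far]] : exists s : 'I_n.+1, s \in J /\ (j' + (d - 3) < s \/ s + (d - 3) < j').
  apply: contrapT => H; apply: ncJ' => s sJ.
  by split; rewrite leqNgt; apply/negP => far; apply: H; exists s; split; [|left| |right].
left.
have s2 := cJ.1 s sJ.
have mem (k : 'I_n.+1) : k \in gapped J :&: gapped [set j']%SET -> k = 0 :> nat \/
   [/\ k <> s :> nat, s < k + d.-1 & k < s + d.-1] /\
   [/\ k <> j' :> nat, j' < k + d.-1 & k < j' + d.-1].
  rewrite finset.in_setI => /andP[/in_gapped [->|Hs]]; first by left.
  move=> /in_gapped [->|Hj]; first by left.
  by right; split; [apply: Hs | apply: Hj; rewrite inE].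
case: far => far.
  apply: (@short_far _ j' s) => //; try lia.
  by move=> k /mem [->|[[k1 k2 k3] [k4 k5 k6]]]; [left | right].
apply: (@short_far _ s j') => //; try lia.
by move=> k /mem [->|[[k1 k2 k3] [k4 k5 k6]]]; [left | right].
Qed.

Lemma clustered_extremes J : clustered J -> J != finset.set0 ->
  exists a b : 'I_n.+1, [/\ a \in J, b \in J & forall t, t \in J -> a <= t <= b].
Proof.
move=> cJ /set0Pn [i iJ].
have [a aJ amin] := arg_minnP (fun k : 'I_n.+1 => k : nat) iJ.
have [b bJ bmax] := arg_maxnP (fun k : 'I_n.+1 => k : nat) iJ.
by exists a, b; split => // t tJ; rewrite amin //=; apply: bmax.
Qed.

(** The extreme vertices of the common window lie outside [J], on either side of
it. *)
Lemma gapped_long J : clustered J -> exists u v : 'I_n.+1,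
  [/\ u \in gapped J, v \in gapped J, 0 < u & u + d.-1 <= v].
Proof.
move=> cJ; have [->|J0] := eqVneq J finset.set0.
  have n1 : 1 < n.+1 by lia.
  exists (Ordinal n1), ord_max; rewrite gapped0 !inE; split => //=; lia.
have [a [b [aJ bJ ab]]] := clustered_extremes cJ J0.
have [J1 J2] := cJ.
have := J1 _ aJ; have := J1 _ bJ; have := J2 _ _ bJ aJ => ? ? ?.
have un : maxn 1 (b - (d - 2)) < n.+1 by lia.
have vn : minn n (a + (d - 2)) < n.+1 by lia.
exists (Ordinal un), (Ordinal vn); split => /=; try lia.
  apply/in_gapped; right=> t /ab tab /=; split; lia.
apply/in_gapped; right=> t /ab tab /=; split; lia.
Qed.

(** An index [t] of [J] is missing from the common face. If [t] is not in [J'], some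
[s] in [J'] must be at distance at least [d - 1] from it; then all vertices other
than [x_0] are squeezed between [s] and [t], which contradicts [gapped_long]. *)
Lemma gapped_subset_inj J J' : clustered J -> clustered J' ->
  gapped J = gapped J' -> J \subset J'.
Proof.
move=> cJ cJ' E; apply/fintype.subsetP => t tJ; apply: contrapT => /negP tJ'.
have [u [v [uJ vJ u0 uv]]] := gapped_long cJ.
have [/(_ t tJ) t2 _] := cJ.
have : t \notin gapped J'.
  rewrite -E; apply/negP => /in_gapped [t0|/(_ t tJ) []//].
  by move: t2; rewrite t0.
move=> /in_gapped H; apply: H; right=> s sJ'.
have [u1|/(_ t tJ) [u1 u2 u3]] := in_gapped _ _ uJ; first by move: u0; rewrite u1.
have [v1|/(_ t tJ) [v1 v2 v3]] := in_gapped _ _ vJ; first by move: uv; rewrite v1; lia.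
rewrite E in uJ vJ.
have [u4|/(_ s sJ') [u4 u5 u6]] := in_gapped _ _ uJ; first by move: u0; rewrite u4.
have [v4|/(_ s sJ') [v4 v5 v6]] := in_gapped _ _ vJ; first by move: uv; rewrite v4; lia.
split; try lia.
by move=> /val_inj ts; move: tJ'; rewrite ts sJ'.
Qed.

Lemma gapped_inj J J' : clustered J -> clustered J' -> gapped J = gapped J' -> J = J'.
Proof.
move=> cJ cJ' E; apply/eqP; rewrite finset.eqEsubset.
by rewrite !gapped_subset_inj.
Qed.

Lemma gapped_not_short J : clustered J -> ~ short (gapped J).
Proof.
move=> cJ; have [u [v [uJ vJ u0 uv]]] := gapped_long cJ.
have zJ : ord0 \in gapped J by apply/in_gapped; left.
have vn := ltn_ord v.
case=> [[i id]|/fintype.subsetP H|[t tn] /fintype.subsetP H].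
- move=> /fintype.subsetP H; move: (H _ zJ) (H _ vJ); rewrite !inE /=; lia.
- by move: (H _ uJ) (H _ vJ); rewrite !inE /=; lia.
- by move: (H _ uJ) (H _ vJ); rewrite !inE /=; lia.
Qed.

Lemma clustered_window J : clustered J -> exists2 s, (2 <= s) && (s + (d - 2) <= n) &
  forall t : 'I_n.+1, t \in J -> s <= t < s + (d - 2).
Proof.
move=> cJ; have [->|J0] := eqVneq J finset.set0.
  by exists 2; [lia | move=> t; rewrite inE].
have [a [b [aJ bJ ab]]] := clustered_extremes cJ J0.
have [J1 J2] := cJ.
have := J1 _ aJ; have := J1 _ bJ; have := J2 _ _ bJ aJ => ? ? ?.
exists (minn a (n - (d - 2))); first by lia.
move=> t /[dup] /J1 ? /ab; lia.
Qed.

(** This provides the descending chains of faces that bound the rank from below. *)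
Lemma clustered_extend J : clustered J -> #|J| < d - 2 ->
  exists t : 'I_n.+1, t \notin J /\ clustered (t |: J).
Proof.
move=> cJ cardJ; have [s sn sJ] := clustered_window cJ.
pose W := [set k : 'I_n.+1 | s <= k < s + (d - 2)]%SET.
have [t tW tJ] : exists2 t, t \in W & t \notin J.
  apply: contrapT => H; have : W \subset J.
    by apply/fintype.subsetP => t tW; apply: contrapT => /negP tJ; apply: H; exists t.
  by move=> /subset_leq_card; rewrite card_window; [by rewrite leqNgt cardJ | lia].
have WtJ k : k \in t |: J -> s <= k < s + (d - 2).
  rewrite !inE => /orP[/eqP ->|/sJ //].
  by move: tW; rewrite inE.
exists t; split => //; split=> [k /WtJ|k l /WtJ ? /WtJ]; lia.
Qed.

Lemma short_edge (u : 'I_n.+1) : 0 < u -> short [set ord0; u]%SET.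
Proof.
move=> u0; have un := ltn_ord u; have [ud|ud] := ltnP u d.
  constructor 1; exists 0; first by lia.
  by apply/fintype.subsetP => k; rewrite !inE => /orP[] /eqP -> /=; lia.
have [ud'|ud'] := leqP n (u + (d - 2)).
  constructor 2; apply/fintype.subsetP => k; rewrite !inE => /orP[] /eqP -> //=; lia.
constructor 3; exists u.-1; first by lia.
by apply/fintype.subsetP => k; rewrite !inE => /orP[] /eqP -> //=; lia.
Qed.

Lemma card_Elast : #|Eset n d n| = d.
Proof.
have -> : Eset n d n = ord0 |: [set k : 'I_n.+1 | (n - d).+2 <= k < (n - d).+2 + d.-1]%SET.
  by apply/setP => k; rewrite !inE -val_eqE /=; have := ltn_ord k; lia.
by rewrite cardsU1 card_window ?inE /=; lia.
Qed.

End Combinatorics.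

Section Classification.
Variables (R : realType) (m n d : nat) (x : 'I_n.+1 -> 'rV[R]_m).
Hypotheses (d3 : (3 <= d)%N) (dn : (d <= n)%N).
Hypotheses (cpx : convex_position x) (rT : rk x [set: 'I_n.+1]%SET = d.+1).
Hypothesis facetP : forall X,
  exposed x [set: 'I_n.+1]%SET X /\ rk x X = d <-> brax_facet d X.
Implicit Types (X Y F J : {set 'I_n.+1}).
Local Notation T := [set: 'I_n.+1]%SET.
Local Open Scope nat_scope.

(** Shrink a shape containing [X] by intersecting it with facets through [X] for
as long as it is larger than [X]. *)
Lemma exposed_shape X : exposed x T X -> shape d X.
Proof.
move=> eX; suff H N Y : #|Y| <= N -> X \subset Y -> shape d Y -> shape d X.
  apply: (H _ T (leqnn _)); first exact: finset.subsetT.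
  by right; exists finset.set0; [exact: clustered0 | rewrite gapped0].
elim: N Y => [|N IH] Y cY XY sY.
  suff -> : X = Y by [].
  move: cY XY; rewrite leqn0 cards_eq0 => /eqP ->.
  by rewrite finset.subset0 => /eqP.
have [->//|neXY] := eqVneq X Y.
have /properP [_ [i iY iX]] : X \proper Y by rewrite finset.properEneq neXY.
have [F [eF XF iF rF]] := exposed_in_facet eX (finset.in_setT i) iX.
have bF : brax_facet d F by apply/facetP; split => //; move: rF; rewrite rT => -[].
apply: (IH (Y :&: F)); last exact: shapeI_facet.
  rewrite -ltnS; apply: leq_trans cY; apply: proper_card; apply/properP.
  split; first exact: finset.subsetIl.
  by exists i => //; rewrite finset.in_setI negb_and iF orbT.
by rewrite finset.subsetI XY.
Qed.

Lemma facet_exposed F : brax_facet d F -> exposed x T F.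
Proof. by move=> /facetP []. Qed.

Lemma indep_Tset i : i + d <= n.+1 -> indep x (Tset n d i).
Proof.
move=> idn; have [_ r] : exposed x T (Tset n d i) /\ rk x (Tset n d i) = d.
  by apply/facetP; left; exists i.
by rewrite /indep r /Tset card_window.
Qed.

Lemma indep_Elast : indep x (Eset n d n).
Proof.
have [_ r] : exposed x T (Eset n d n) /\ rk x (Eset n d n) = d.
  by apply/facetP; right; exists n => //; lia.
by rewrite /indep r (card_Elast d3 dn).
Qed.

(** The consecutive vertices lie in the simplex [T_(t+1)], a facet that misses
[x_0]; so [x_0] is affinely independent of them. *)
Lemma apex_window_exposed t : 2 <= t -> t + d <= n ->
  indep x (apex_window n d t) /\ exposed x T (apex_window n d t).
Proof.
move=> t2 tn; split; last first.
  have -> : apex_window n d t = Eset n d t :&: Eset n d (t + d.-1).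
    by apply/setP => k; rewrite !inE; have := ltn_ord k; lia.
  apply: exposedI; apply: facet_exposed; right; first by exists t => //; lia.
  by exists (t + d.-1) => //; lia.
pose W := [set k : 'I_n.+1 | t < k & k.+1 < t + d]%SET.
have -> : apex_window n d t = ord0 |: W.
  by apply/setP => k; rewrite !inE -val_eqE.
have bT : brax_facet d (Tset n d t.+1) by left; exists t.+1 => //; lia.
have WT : W \subset Tset n d t.+1.
  by apply/fintype.subsetP => k; rewrite !inE; lia.
apply: indepU1; first by apply: indepS WT; apply: indep_Tset; lia.
have : lift1 (x ord0) \notin hspan x (Tset n d t.+1).
  by apply: exposed_notin_hspan (facet_exposed bT) (finset.in_setT _) _; rewrite inE.
by apply: contra; apply: (subvP (hspanS x WT)).
Qed.

Lemma short_exposed X : short d X -> indep x X /\ exposed x T X.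
Proof.
have sub Y : indep x Y -> exposed x T Y -> X \subset Y -> indep x X /\ exposed x T X.
  move=> iY eY XY; have [iX eX] := indepS_exposed iY XY; split => //.
  exact: exposed_trans eX.
case=> [[i idn XT]|XE|[t /andP[t2 tn] XA]].
- apply: sub XT; first exact: indep_Tset.
  by apply: facet_exposed; left; exists i.
- apply: sub XE; first exact: indep_Elast.
  by apply: facet_exposed; right; exists n => //; lia.
- by have [iA eA] := apex_window_exposed t2 tn; apply: sub XA.
Qed.

Lemma gapped_exposed J : clustered d J -> exposed x T (gapped d J).
Proof.
move: {2}#|J| (erefl #|J|) => N; elim: N J => [|N IH] J JN cJ.
  by move: JN => /cards0_eq ->; rewrite gapped0; exact: exposed_refl.
have [t tJ] : exists t, t \in J by apply/set0Pn; rewrite -cards_eq0 JN.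
have tn := cJ.1 t tJ.
rewrite -(finset.setD1K tJ) gappedU gapped1 //; apply: exposedI.
  by apply: facet_exposed; right; exists t => //; lia.
apply: IH; first by move: JN; rewrite (cardsD1 t J) tJ => -[].
by apply: clusteredS cJ; exact: finset.subsetDl.
Qed.

Lemma gapped_rk_lt J t : clustered d (t |: J) -> t \notin J ->
  rk x (gapped d (t |: J)) < rk x (gapped d J).
Proof.
move=> ctJ tJ; have cJ : clustered d J by apply: clusteredS ctJ; exact: finset.subsetUr.
apply: rk_lt.
  apply: exposed_restrict (gapped_exposed ctJ); last exact: finset.subsetT.
  by rewrite gappedU; exact: finset.subsetIr.
apply: contraNneq tJ => E.
by rewrite -(gapped_inj d3 dn ctJ cJ E) !inE eqxx.
Qed.

(** Upper bound: the rank drops strictly with each element added to [J]. Lower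
bound: add elements until there are [d - 2]; the face then still contains an
edge through [x_0] and a further vertex, so its rank is at least 3. *)
Lemma gapped_rk J : clustered d J -> rk x (gapped d J) + #|J| = d.+1.
Proof.
move=> cJ; apply/eqP; rewrite eqn_leq; apply/andP; split.
  move: {2}#|J| (erefl #|J|) => N; elim: N J cJ => [|N IH] J cJ JN.
    by move: JN => /cards0_eq ->; rewrite gapped0 rT cards0 addn0.
  have [t tJ] : exists t, t \in J by apply/set0Pn; rewrite -cards_eq0 JN.
  have cD : #|J :\ t| = N by move: JN; rewrite (cardsD1 t J) tJ => -[].
  have clD : clustered d (J :\ t) by apply: clusteredS cJ; exact: finset.subsetDl.
  have /= := IH _ clD cD; have := @gapped_rk_lt (J :\ t) t.
  rewrite finset.setD1K // !inE eqxx => /(_ cJ isT).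
  by rewrite JN cD; lia.
move: {2}(d - 2 - #|J|) (erefl (d - 2 - #|J|)) => N; elim: N J cJ => [|N IH] J cJ JN.
  have [u [v [uJ vJ u0 uv]]] := gapped_long d3 dn cJ.
  have [iE eE] := short_exposed (short_edge d3 dn u0).
  have zJ : ord0 \in gapped d J by apply/in_gapped; left.
  have : rk x [set ord0; u]%SET < rk x (gapped d J).
    apply: rk_lt.
      apply: exposed_restrict eE; last exact: finset.subsetT.
      by apply/fintype.subsetP => k; rewrite finset.in_set2 => /orP[] /eqP ->.
    apply/negP => /eqP E; move: vJ; rewrite -E !inE.
    by move=> /orP[] /eqP vE; move: uv u0; rewrite vE /=; lia.
  have c2 : #|[set ord0; u]%SET| = 2 by rewrite cards2 -val_eqE /= eq_sym -lt0n u0.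
  by rewrite (eqP iE) c2; move: JN; lia.
have [|t [tJ ctJ]] := clustered_extend d3 dn cJ; first by lia.
have cU : #|t |: J| = #|J|.+1 by rewrite cardsU1 tJ.
have JN' : d - 2 - #|J|.+1 = N by move: JN; lia.
have := IH _ ctJ; rewrite cU => /(_ JN').
move=> IHt; apply: (leq_trans IHt); rewrite addnS -addSn leq_add2r.
exact: gapped_rk_lt.
Qed.

End Classification.

(** * Faces of braxtopes are braxtopes *)

(** The vertices of [E_j] are 0 and the elements other than [j] of the window from
[lo] to [hi], that is, [E_j] has [hi - lo + 1] vertices. *)
Section FacetCombinatorics.
Variables (n d j lo hi : nat).
Hypotheses (loE : lo = maxn 1 (j - (d - 2))) (hiE : hi = minn n (j + (d - 2))).
Hypotheses (d4 : (4 <= d)%N) (dn : (d <= n)%N) (jn : (2 <= j < n)%N).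
Local Open Scope nat_scope.

Local Notation n' := (hi - lo).

(** The index of the [k]-th vertex of [E_j]. *)
Definition rank_nat k := if k == 0 then 0 else if lo + k <= j then lo + k - 1 else lo + k.

Lemma rank_natP k : [\/ k = 0 /\ rank_nat k = 0, [/\ 0 < k, lo + k <= j & rank_nat k = lo + k - 1] |
  [/\ 0 < k, j < lo + k & rank_nat k = lo + k]].
Proof.
rewrite /rank_nat; case: eqP => [->|k0]; first by constructor 1.
by case: (leqP (lo + k) j) => H; [constructor 2 | constructor 3]; split => //; lia.
Qed.

Lemma rank_nat_lt k : k <= n' -> rank_nat k < n.+1.
Proof.
by case: (rank_natP k) => [[? ->]|[? ? ->]|[? ? ->]]; lia.
Qed.

Definition rank_ord (k : 'I_n'.+1) : 'I_n.+1 := Ordinal (rank_nat_lt (ltn_ord k)).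
Local Notation p := rank_ord.

Lemma rank_mono k l : k < l -> rank_nat k < rank_nat l.
Proof.
by case: (rank_natP k) => [[? ->]|[? ? ->]|[? ? ->]];
  case: (rank_natP l) => [[? ->]|[? ? ->]|[? ? ->]]; lia.
Qed.

Lemma rank_inj : injective p.
Proof.
move=> k l /(congr1 val) /= E; apply: val_inj => /=.
by have [/rank_mono|/rank_mono|//] := ltngtP k l; rewrite E ltnn.
Qed.

(** Both sides are strictly increasing with the same elements. *)
Lemma enum_Eset : enum (Eset n d j) = [seq p k | k <- enum 'I_n'.+1].
Proof.
apply: (inj_map val_inj); rewrite -map_comp.
have -> : [seq (val \o p) k | k <- enum 'I_n'.+1] = [seq rank_nat k | k <- iota 0 n'.+1].
  by rewrite -[in RHS]val_enum_ord -[in RHS]map_comp.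
apply: (irr_sorted_eq ltn_trans ltnn).
- rewrite sorted_map /enum_mem -enumT; apply: sorted_filter.
    by move=> ? ? ?; apply: ltn_trans.
  by have := iota_ltn_sorted 0 n.+1; rewrite -val_enum_ord sorted_map.
- apply: (homo_sorted (e := ltn)); [exact: rank_mono | exact: iota_ltn_sorted].
move=> i; apply/mapP/mapP => [[k]|[k]].
  rewrite mem_enum inE => kE ->.
  have kn := ltn_ord k.
  pose l := if k == 0 :> nat then 0 else if k < j then k + 1 - lo else k - lo.
  have lE : [\/ l = 0 /\ k = 0 :> nat, [/\ 0 < k, k < j & l = k + 1 - lo] |
      [/\ 0 < k, j <= k & l = k - lo]].
    rewrite /l; case: eqP => [k0|k0]; first by constructor 1.
    by case: ltnP => H; [constructor 2 | constructor 3]; split => //; lia.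
  clearbody l; exists l.
    by rewrite mem_iota; case: lE => [[? ?]|[? ? ->]|[? ? ->]]; lia.
  change (k = rank_nat l :> nat).
  by case: (rank_natP l) => [[? ->]|[? ? ->]|[? ? ->]];
    case: lE => [[? ?]|[? ? ?]|[? ? ?]]; lia.
rewrite mem_iota => kn ->.
have kn' : rank_nat k < n.+1 by apply: rank_nat_lt; lia.
exists (Ordinal kn') => //; rewrite mem_enum inE /=.
move: kn.
by case: (rank_natP k) => [[? ->]|[? ? ->]|[? ? ->]]; lia.
Qed.

Variable K : {set 'I_n'.+1}.
Local Notation Z := (p @: K)%SET.

Lemma rank_ordP (k : 'I_n'.+1) : [/\ k <= n', p k <= n &
   [\/ k = 0 :> nat /\ p k = 0 :> nat, [/\ 0 < k, lo + k <= j & p k = lo + k - 1 :> nat] |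
  [/\ 0 < k, j < lo + k & p k = lo + k :> nat]]].
Proof.
split; [by have := ltn_ord k; lia | by have := ltn_ord (p k); lia | ].
exact: rank_natP.
Qed.

(** In each case it suffices to place [K] inside a set [T_i] of the smaller
braxtope, because the cardinalities agree. The index is that of the least
vertex of the window, moved back into the admissible range if necessary. *)
Lemma facet_of_E_short0 : short d Z -> #|K| = d.-1 -> ord0 \notin K ->
  exists2 i, i + d.-1 <= n'.+1 & K = Tset n' d.-1 i.
Proof.
move=> sZ cK K0.
have sub i : i + d.-1 <= n'.+1 -> K \subset Tset n' d.-1 i -> K = Tset n' d.-1 i.
  by move=> idn KT; apply/eqP; rewrite eqEcard KT cK /Tset card_window /= ?leqnn.
have key i : (forall k, k \in K -> i <= p k < i + d) ->
    exists2 i, i + d.-1 <= n'.+1 & K = Tset n' d.-1 i.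
  move=> H; pose i' := maxn 1 (minn (i + 1 - lo) (n'.+1 - d.-1)).
  have i'n : i' + d.-1 <= n'.+1 by rewrite /i'; lia.
  exists i' => //; apply: sub => //; apply/fintype.subsetP => k kK.
  have k0 : k <> 0 :> nat by move=> k0; move: K0; rewrite -(_ : k = ord0) ?kK //; apply: val_inj.
  have [kn pn kP] := rank_ordP k; rewrite inE; have := H k kK.
  rewrite /i'.
  by case: kP => [[? ?]|[? ? ->]|[? ? ->]]; lia.
have memZ k : k \in K -> p k \in Z by move=> kK; apply: imset_f.
have p0 k : k \in K -> p k <> 0 :> nat.
  move=> kK E; have [_ _ kP] := rank_ordP k.
  have k0 : k = 0 :> nat by case: kP => [[]//|[]|[]]; rewrite E; lia.
  by move: K0; rewrite -(_ : k = ord0) ?kK //; apply: val_inj.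
case: sZ => [[i id] /fintype.subsetP H|/fintype.subsetP H|[t tn] /fintype.subsetP H].
- by apply: (key i) => k /memZ /H; rewrite inE.
- apply: (key (n.+1 - d)) => k kK; have := H _ (memZ k kK); have := p0 k kK.
  by have [_ pn _] := rank_ordP k; rewrite inE; lia.
- apply: (key t) => k kK; have := H _ (memZ k kK); have := p0 k kK.
  by rewrite inE; lia.
Qed.

(** On one side of [j] the set [E_j] has at most [d - 2] elements. So the short
sets through [x_0] lie to the left or to the right of [j]; a window with [j] in
its interior loses [j] and has too few elements. *)
Lemma facet_of_E_short1 : short d Z -> #|K| = d.-1 -> ord0 \in K ->
  K = Tset n' d.-1 0 \/ K = Eset n' d.-1 n'.
Proof.
move=> sZ cK K0.
have d'n' : d.-1 <= n' by lia.
have subT : (forall k : 'I_n'.+1, k \in K -> k < d.-1) -> K = Tset n' d.-1 0.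
  move=> H; apply/eqP; rewrite eqEcard cK /Tset card_window ?leqnn ?andbT; last by lia.
  by apply/fintype.subsetP => k /H; rewrite inE; lia.
have subE : (forall k : 'I_n'.+1, k \in K -> k = 0 :> nat \/ n' <= k + (d.-1 - 2)) ->
    K = Eset n' d.-1 n'.
  move=> H; apply/eqP; rewrite eqEcard cK card_Elast; [|lia|lia].
  rewrite leqnn andbT; apply/fintype.subsetP => k /H; rewrite inE; have := ltn_ord k; lia.
have memZ k : k \in K -> p k \in Z by move=> kK; apply: imset_f.
case: sZ => [[i id] /fintype.subsetP H|/fintype.subsetP H|[t tn] /fintype.subsetP H].
- left; apply: subT => k kK.
  have := H _ (memZ _ K0); have := H _ (memZ _ kK); rewrite !inE /= => kT T0.
  have [_ _ kP] := rank_ordP k; move: kT T0; rewrite /=.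
  have -> : rank_nat 0 = 0 by [].
  by case: kP => /= [[k0 ->]|[? ? ->]|[? ? ->]]; lia.
- right; apply: subE => k kK.
  have := H _ (memZ _ kK); rewrite !inE => kT.
  have [kn pn kP] := rank_ordP k.
  by case: kP => [[? ?]|[? ? ?]|[? ? ?]]; lia.
have [tj|tj] := leqP j t.
  right; apply: subE => k kK.
  have := H _ (memZ _ kK); rewrite !inE => kT.
  have [kn pn kP] := rank_ordP k.
  by case: kP => [[? ?]|[? ? ?]|[? ? ?]]; lia.
have [tj'|tj'] := leqP (t + d) j.+1.
  left; apply: subT => k kK.
  have := H _ (memZ _ kK); rewrite !inE => kT.
  have [kn pn kP] := rank_ordP k.
  by case: kP => [[? ?]|[? ? ?]|[? ? ?]]; lia.
exfalso; have jN : j < n.+1 by lia.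
have : #|Z| < #|apex_window n d t|.
  apply: proper_card; apply/properP; split; first exact/fintype.subsetP.
  exists (Ordinal jN); first by rewrite inE /=; lia.
  apply/negP => /imsetP [k kK /(congr1 val) /= jk].
  by have [kn pn kP] := rank_ordP k; case: kP => /= [[? ?]|[? ? ?]|[? ? ?]]; lia.
rewrite card_imset; last exact: rank_inj.
have -> : apex_window n d t = ord0 |: [set k : 'I_n.+1 | t.+1 <= k < t.+1 + (d - 2)]%SET.
  by apply/setP => k; rewrite !inE -val_eqE /=; lia.
by rewrite cardsU1 card_window ?inE /= ?cK; lia.
Qed.

(** The two far vertices of the face lie in [E_j] on either side of [j], which
forces [j] into [J]; the other element of [J] is the index omitted by the facet
of the smaller braxtope. *)
Lemma facet_of_E_gapped J : clustered d J -> Z = gapped d J -> #|J| = 2 ->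
  exists2 k, 2 <= k < n' & K = Eset n' d.-1 k.
Proof.
move=> cJ ZE J2.
have d3 : 2 < d by lia.
have [u [v [uJ vJ u0 uv]]] := gapped_long d3 dn cJ.
have jN : j < n.+1 by lia.
pose j' := Ordinal jN.
have pZ (i : 'I_n.+1) : i \in gapped d J -> 0 < i -> [/\ i <> j :> nat, j < i + d.-1 & i < j + d.-1].
  rewrite -ZE => /imsetP [k _ ->] i0; have [kn pn kP] := rank_ordP k.
  by case: kP => [[? ?]|[? ? ?]|[? ? ?]]; split; lia.
have [u1 u2 u3] := pZ u uJ u0; have [|v1 v2 v3] := pZ v vJ; first by lia.
have jJ : j' \in J.
  apply: contrapT => /negP jJ.
  have : j' \notin gapped d J by apply/negP => /pZ []//=; lia.
  move=> /in_gapped H; apply: H; right=> s sJ.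
  have [?|/(_ s sJ) [? ? ?]] := in_gapped _ _ _ uJ; first by lia.
  have [?|/(_ s sJ) [? ? ?]] := in_gapped _ _ _ vJ; first by lia.
  split; rewrite /=; try lia.
  by move=> js; move: jJ; rewrite (_ : j' = s) ?sJ //; apply: val_inj.
have /eqP /cards1P [t tE] : #|J :\ j'| = 1 by move: J2; rewrite (cardsD1 j' J) jJ => -[].
have JE : J = [set j'; t]%SET by rewrite -tE finset.setD1K.
have tJ : t \in J by rewrite JE !inE eqxx orbT.
have tj : t <> j :> nat.
  move=> tj; have : t \in J :\ j' by rewrite tE inE.
  by rewrite !inE (_ : t = j') ?eqxx //; apply: val_inj.
have [c1 c2] := cJ; have t2 := c1 _ tJ.
have := c2 _ _ tJ jJ; have := c2 _ _ jJ tJ => /= ? ?.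
pose k := if t < j then t + 1 - lo else t - lo.
have kE : [\/ t < j /\ k = t + 1 - lo | j < t /\ k = t - lo].
  by rewrite /k; case: ltnP => H; [constructor 1 | constructor 2]; split => //; lia.
have kn : 2 <= k < n'.
  by case: kE => -[? ->]; lia.
exists k => //; apply/setP => l.
have [ln pl lP] := rank_ordP l.
rewrite -(mem_imset _ _ rank_inj) ZE [RHS]inE; apply/in_gapped/idP.
  rewrite JE => -[l0|H].
    by case: lP => [[-> //]|[? ? ?]|[? ? ?]]; lia.
  have [|a1 a2 a3] := H j'; first by rewrite !inE eqxx.
  have [|b1 b2 b3] := H t; first by rewrite !inE eqxx orbT.
  clearbody k; clear -loE hiE a1 a2 a3 b1 b2 b3 ln kn kE lP d4 dn jn t2 tj.
  by case: kE => -[? kk]; rewrite kk in kn *; case: lP => [[-> //]|[? ? ?]|[? ? ?]]; lia.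
move=> H; have [l0|l0] := eqVneq (l : nat) 0.
  by left; case: lP => [[]//|[]|[]]; lia.
rewrite /= in lP; clearbody k; right=> s; rewrite JE !inE => /orP[] /eqP -> /=.
  by clear -loE hiE H l0 ln kn kE lP d4 dn jn t2 tj; case: lP => [[? ?]|[? ? ?]|[? ? ?]]; split; lia.
by clear -loE hiE H l0 ln kn kE lP d4 dn jn t2 tj; case: kE => -[? kk]; rewrite kk in H kn;
  case: lP => [[? ?]|[? ? ?]|[? ? ?]]; split; lia.
Qed.

(** By [exposed_shape] and the rank formulas, the right-hand side says that the
image of [K] is a face of [E_j] of rank [d - 1]. *)
Lemma facet_of_E : brax_facet d.-1 K <->
  (short d Z /\ #|K| = d.-1) \/ (exists J, [/\ clustered d J, Z = gapped d J & #|J| = 2]).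
Proof.
split; last first.
  case=> [[sZ cK]|[J [cJ ZE J2]]]; last first.
    by have [k kn ->] := facet_of_E_gapped cJ ZE J2; right; exists k => //; lia.
  have [K0|K0] := boolP (ord0 \in K).
    have [->|->] := facet_of_E_short1 sZ cK K0.
      by left; exists 0 => //; lia.
    by right; exists n' => //; rewrite leqnn andbT; lia.
  by have [i ? ->] := facet_of_E_short0 sZ cK K0; left; exists i.
case=> [[i idn KE]|[k kn KE]].
  left; split; last by rewrite KE /Tset card_window.
  (* A window of [d - 1] vertices of [E_j] avoiding 0 has [j] in its interior. *)
  have [i0|i0] := eqVneq i 0.
    rewrite i0 in KE idn.
    (* The first [d - 1] vertices of [E_j]: all of them but 0 precede [j] unless the
       window of [E_j] is truncated on the left. *)
    have [ld|ld] := leqP lo 2.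
      constructor 1; exists 0; first by lia.
      apply/fintype.subsetP => _ /imsetP [k kK ->]; move: kK; rewrite KE !inE => kd.
      have [kn pn kP] := rank_ordP k.
      by case: kP => [[? ->]|[? ? ->]|[? ? ->]]; lia.
    constructor 3; exists lo.-1; first by lia.
    apply/fintype.subsetP => _ /imsetP [k kK ->]; move: kK; rewrite KE !inE => kd.
    have [kn pn kP] := rank_ordP k.
    by case: kP => [[? ->]|[? ? ->]|[? ? ->]]; lia.
  pose i' := lo + i - 1.
  constructor 1; exists i'; first by rewrite /i'; lia.
  apply/fintype.subsetP => _ /imsetP [k kK ->]; move: kK; rewrite KE !inE => kd.
  have [kn pn kP] := rank_ordP k; rewrite /i'.
  by case: kP => [[? ->]|[? ? ->]|[? ? ->]]; lia.
have [kn'|kn'] := eqVneq k n'.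
  left; rewrite kn' in KE; split; last first.
    by rewrite KE card_Elast //; lia.
  have [jd|jd] := leqP (j + d) n.
    constructor 3; exists j; first by lia.
    apply/fintype.subsetP => _ /imsetP [l lK ->]; move: lK; rewrite KE !inE => ld.
    have [ln pn lP] := rank_ordP l.
    by case: lP => [[? ->]|[? ? ->]|[? ? ->]]; lia.
  constructor 2.
  apply/fintype.subsetP => _ /imsetP [l lK ->]; move: lK; rewrite KE !inE => ld.
  have [ln pn lP] := rank_ordP l.
  by case: lP => [[? ->]|[? ? ->]|[? ? ->]]; lia.
(* Otherwise the facet omits the [k]-th vertex [t] of [E_j], and it is the common
   part of [E_j] and [E_t]. *)
right; have jN : j < n.+1 by lia.
have kN : k < n'.+1 by lia.
pose j' := Ordinal jN.
have [_ tn tP] := rank_ordP (Ordinal kN).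
move: (p (Ordinal kN)) tn tP => t /= tn tP.
have t2 : 2 <= t < n.
  by case: tP => [[? ?]|[? ? ?]|[? ? ?]]; lia.
have tj : t <> j :> nat.
  by case: tP => [[? ?]|[? ? ?]|[? ? ?]]; lia.
have tjd : t <= j + (d - 3) /\ j <= t + (d - 3).
  by case: tP => [[? ?]|[? ? ?]|[? ? ?]]; lia.
exists [set j'; t]%SET; split.
- split=> [s|s s']; rewrite !inE; first by move=> /orP[] /eqP ->.
  by move=> /orP[] /eqP -> /orP[] /eqP -> /=; lia.
- apply/setP => i; apply/imsetP/in_gapped => [[l lK ->]|].
    move: lK; rewrite KE inE => lk; have [ln pn lP] := rank_ordP l.
    have [l0|l0] := eqVneq (l : nat) 0; first by left; case: lP => [[]//|[]|[]]; lia.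
    rewrite /= in lP; right=> s; rewrite !inE => /orP[] /eqP -> /=.
      by clear -loE hiE l0 ln lP d4 dn jn; case: lP => [[? ?]|[? ? ?]|[? ? ?]]; split; lia.
    by clear -loE hiE lk l0 ln kn kn' tP lP d4 dn jn t2 tj; case: tP => [[? ?]|[? ? ?]|[? ? ?]];
      case: lP => [[? ?]|[? ? ?]|[? ? ?]]; split; lia.
  move=> H; have iE : i \in Eset n d j.
    case: H => [i0|H]; first by rewrite inE i0.
    by have [|] := H j'; rewrite !inE ?eqxx //=; lia.
  have : i \in enum (Eset n d j) by rewrite mem_enum.
  rewrite enum_Eset => /mapP [l _ il]; exists l => //.
  rewrite KE inE; have [ln pn lP] := rank_ordP l; rewrite -il in pn lP.
  have [//|l0] := eqVneq (l : nat) 0.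
  have i0 : i <> 0 :> nat by case: lP => [[]|[]|[]]; lia.
  case: H => [//|H]; have [|a1 a2 a3] := H t; first by rewrite !inE eqxx orbT.
  clear H.
  by clear -loE hiE a1 a2 a3 l0 ln kn kn' tP lP d4 dn jn t2 tj; case: tP => [[? ?]|[? ? ?]|[? ? ?]];
    case: lP => [[? ?]|[? ? ?]|[? ? ?]]; lia.
rewrite cards2 -val_eqE /= eq_sym; by move/eqP: tj => ->.
Qed.

End FacetCombinatorics.

Section FacetsAreBraxtopes.
Variables (R : realType) (m n d : nat) (xs : seq 'rV[R]_m).
Hypothesis (sn : size xs = n.+1).
Local Notation x := (vtx xs (N:=n.+1)).
Local Notation T := [set: 'I_n.+1]%SET.
Hypotheses (d3 : (3 <= d)%N) (dn : (d <= n)%N).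
Hypotheses (cpx : convex_position x) (rT : rk x T = d.+1).
Hypothesis facetP : forall X, exposed x T X /\ rk x X = d <-> brax_facet d X.

(** A facet other than [E_j] with [2 <= j < n] has [d] vertices and is a simplex;
so is every facet when [d = 3]. *)
Lemma facet_braxtope X : brax_facet d X ->
  braxtope (d%:Z - 1) (induced xs (hull x X)) (hull x X).
Proof.
move=> bX; rewrite induced_hull //.
have [eX rX] := (facetP X).2 bX.
have mem_en : enum X =i X by move=> i; rewrite mem_enum.
have [cX|cX] := eqVneq #|X| d.
  rewrite -cX; apply: simplex_braxtope => //; last exact: enum_uniq.
  by rewrite /indep rX cX.
have [j [j2 jn XE]] : exists j, [/\ (2 <= j)%N, (j < n)%N & X = Eset n d j].
  case: bX => [[i idn XE]|[j jn XE]]; first by move: cX; rewrite XE /Tset card_window ?eqxx.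
  exists j; split => //; first by lia.
  have [jn'|] := eqVneq j n; last by lia.
  by move: cX; rewrite XE jn' card_Elast ?eqxx.
have jn2 : (2 <= j < n)%N by rewrite j2.
have d4 : (4 <= d)%N.
  rewrite ltn_neqAle d3 andbT; apply: contraNneq cX => d3E.
  rewrite eqn_leq -{2}rX rk_card andbT XE.
  have j1 : (j.-1 < n.+1)%N by lia.
  have j3 : (j.+1 < n.+1)%N by lia.
  have : Eset n d j \subset [set ord0; Ordinal j1; Ordinal j3]%SET.
    by apply/fintype.subsetP => k; rewrite !inE -!val_eqE /= -d3E; lia.
  move=> /subset_leq_card /leq_trans; apply.
  rewrite -d3E (leq_trans (leq_card_setU _ _)) // cards1 addn1 ltnS.
  by rewrite cards2; case: (_ != _).
pose lo := maxn 1 (j - (d - 2)); pose hi := minn n (j + (d - 2)).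
pose p := @rank_ord n d j lo hi erefl erefl d4 dn jn2.
have pE : enum X = [seq p k | k <- enum 'I_(hi - lo).+1].
  by rewrite XE; exact: enum_Eset.
pose n' := (hi - lo)%N.
pose xs' := [seq x i | i <- enum X].
have sn' : size xs' = n'.+1 by rewrite size_map pE size_map size_enum_ord.
have -> : d%:Z - 1 = (d.-1)%:Z by lia.
have va : vertex_array xs' (hull x X).
  by apply: vertex_array_hull => //; exact: enum_uniq.
have [cpy PE] := (vertex_arrayP _ sn').1 va.
apply/(braxtopeP _ sn'); first by lia.
set y := vtx _ (N := n'.+1) in cpy PE *.
have yE k : y k = x (p k).
  rewrite /y {1}/vtx /xs' pE -map_comp (nth_map ord0) ?size_enum_ord //=.
  by rewrite nth_ord_enum.
have hullE K : hull y K = hull x (p @: K)%SET.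
  congr conv; apply/seteqP; split=> [_ [k kK <-]|_ [_ /imsetP [k kK ->] <-]].
    by exists (p k); [exact: imset_f | rewrite yE].
  by exists k.
have ry : rk y [set: 'I_n'.+1]%SET = d.
  have : has_dim (hull x X) (d%:Z - 1) by apply/has_dim_hull; rewrite rX.
  by rewrite PE => /has_dim_hull; lia.
have p_inj : injective p by exact: rank_inj.
have pX K : (p @: K)%SET \subset X.
  apply/fintype.subsetP => _ /imsetP [k _ ->]; rewrite -mem_enum pE.
  by apply: map_f; rewrite mem_enum.
split => //; first by rewrite prednK //; lia.
  by have := rk_card y [set: 'I_n'.+1]%SET; rewrite ry cardsT card_ord; lia.
move=> K.
have -> : (exposed y [set: 'I_n'.+1]%SET K /\ rk y K = d.-1) <->
    (exposed x T (p @: K)%SET /\ rk x (p @: K)%SET = d.-1).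
  rewrite -(faces_hull_mem cpy) (hullE K) -PE faces_hull_mem //.
  split=> -[eK rK]; split => //; first exact: exposed_trans eK.
  by apply: exposed_restrict eK => //; exact: finset.subsetT.
rewrite (facet_of_E erefl erefl d4 dn jn2); split=> [[eK rK]|].
  have [sK|[J cJ JE]] := exposed_shape d3 dn rT facetP eK.
    left; split => //; have [iK _] := short_exposed d3 dn rT facetP sK.
    by rewrite -(card_imset _ p_inj) -(eqP iK).
  right; exists J; split => //.
  by have := gapped_rk d3 dn rT facetP cJ; rewrite -JE rK; lia.
case=> [[sK cK]|[J [cJ JE J2]]].
  have [iK eK] := short_exposed d3 dn rT facetP sK; split => //.
  by rewrite (eqP iK) card_imset.
have eJ := gapped_exposed d3 dn rT facetP cJ.
have := gapped_rk d3 dn rT facetP cJ.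
by rewrite -JE in eJ *; rewrite J2 addn2 => -[<-]; split.
Qed.

End FacetsAreBraxtopes.

(** The points that witness the simplex are its vertices, so they are the entries of
[xs] up to order. *)
Lemma simplex_indep (R : realType) (m N : nat) (xs : seq 'rV[R]_m) P (d : int) :
  size xs = N -> vertex_array xs P -> simplex d P ->
  N%:Z = d + 1 /\ indep (vtx xs (N:=N)) [set: 'I_N]%SET.
Proof.
move=> sN va [s [[us ai] ss PE]].
have [cpx PE'] := (vertex_arrayP _ sN).1 va.
pose y := vtx s (N:=size s).
have iy : indep y [set: 'I_(size s)]%SET.
  apply: indep_of_aff => i _; apply/negP => /aff_image; apply: contra_not (ai (y i) _).
    apply: affS => _ [k /= kT <-]; split; first by rewrite /= /y /vtx mem_nth.
    by move=> /eqP; rewrite /y /vtx nth_uniq // => /eqP /val_inj E; move: kT; rewrite E !inE eqxx.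
  by rewrite /y /vtx mem_nth.
have cpy : convex_position y by move=> i; case: (indepS_exposed iy (finset.subsetT [set i]%SET)).
have Py : P = hull y [set: 'I_(size s)]%SET by rewrite hull_vtx.
have ms : xs =i s.
  move=> v; have [_ _ vE] := va.
  have E : [set` xs] v <-> v \in s.
    rewrite vE Py; split=> [/(vertex_hull cpy) [i _ ->]|vs]; first exact: mem_nth.
    apply/(vertex_hull cpy); have iv : (index v s < size s)%N by rewrite index_mem.
    by exists (Ordinal iv); rewrite ?inE // /y /vtx nth_index.
  by apply/idP/idP => /E.
have [_ uxs _] := va.
have NE : N = size s by rewrite -sN; apply/perm_size/uniq_perm.
split; first by rewrite NE ss.
rewrite /indep cardsT card_ord NE.
have : has_dim P d by rewrite Py; apply/has_dim_hull; rewrite (eqP iy) cardsT card_ord; lia.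
rewrite PE' => /has_dim_hull; subst N; rewrite NE in ss *; move=> E; apply/eqP; lia.
Qed.

Lemma simplex_face (R : realType) (m : nat) (d : int) (xs : seq 'rV[R]_m) P F :
  vertex_array xs P -> simplex d P -> face P F ->
  exists2 k, has_dim F k & braxtope k (induced xs F) F.
Proof.
move=> va sP; have [_ iT] := simplex_indep erefl va sP.
have [cpx ->] := (vertex_arrayP _ erefl).1 va.
move=> /face_hullP [X eX ->].
have [iX _] := indepS_exposed iT (exposed_sub eX).
exists (#|X|%:Z - 1); first by apply/has_dim_hull; rewrite (eqP iX).
rewrite induced_hull //; apply: simplex_braxtope => //; first exact: enum_uniq.
by move=> i; rewrite mem_enum.
Qed.

(** A proper face lies in a facet, which is a braxtope of smaller dimension, and the
order induced in two steps is the one induced directly. *)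
Lemma braxtope_face (R : realType) (m : nat) (d : nat) (xs : seq 'rV[R]_m) P F :
  braxtope d%:Z xs P -> face P F ->
  exists2 k, has_dim F k & braxtope k (induced xs F) F.
Proof.
elim: d xs P F => [|d IH] xs P F bP; first by case: bP => va /= sP; exact: simplex_face va sP.
have [d2|d3] := leqP d.+1 2.
  have d2' : d.+1%:Z <= 2 by lia.
  by case: bP => va; rewrite d2' => sP; exact: simplex_face va sP.
have [n sn] : exists n, size xs = n.+1.
  case: bP => _; have -> : (d.+1%:Z <= 2) = false by apply/negP; lia.
  move=> [_ dn _]; exists (size xs).-1; rewrite prednK //.
  by move: dn; rewrite /last_index; lia.
have [cpx PE rT dn facetP] := (braxtopeP P sn d3).1 bP.
set x := vtx xs (N:=n.+1) in cpx PE rT facetP.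
rewrite PE => /face_hullP [X eX FE].
have [XT|neX] := eqVneq X [set: 'I_n.+1]%SET.
  exists d.+1%:Z; first by rewrite FE XT; apply/has_dim_hull; rewrite rT; lia.
  rewrite FE XT -PE {1}PE induced_hull // enum_setT -enumT -/x.
  by rewrite /x -vtx_enum.
have /properP [_ [i iT iX]] : X \proper [set: 'I_n.+1]%SET.
  by rewrite finset.properEneq neX finset.subsetT.
have [G [eG XG iG rG]] := exposed_in_facet eX iT iX.
have bG : brax_facet d.+1 G by apply/facetP; split => //; move: rG; rewrite rT => -[].
have := facet_braxtope sn d3 dn cpx rT facetP bG.
have -> : d.+1%:Z - 1 = d%:Z by lia.
move=> bG'; have [|k Fk bF] := IH _ _ F bG'.
  apply/face_hullP; exists X => //.
  by apply: exposed_restrict eX => //; exact: finset.subsetT.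
exists k => //; suff -> : induced xs F = induced (induced xs (hull x G)) F by [].
rewrite /induced -filter_predI; apply: eq_filter => v /=.
have [vF|//] := boolP (v \in F); rewrite /=; apply/esym/mem_set.
by have := set_mem vF; rewrite FE; exact: hullS.
Qed.

(** * Face numbers *)

Section SpacedSets.
Variables (n l : nat) (b : nat -> nat).
Local Open Scope nat_scope.
Implicit Types (S : {set 'I_n.+1}).
Hypothesis b_mono : forall i k, i <= k -> b i <= b k.

Definition spaced u : {set {set 'I_n.+1}} := [set S : {set 'I_n.+1} |
  [forall k in S, (l <= k < u) && [forall i in S, (i < k) ==> (b k <= i)]]]%SET.

Lemma spacedP u S : reflect
  ((forall k : 'I_n.+1, k \in S -> l <= k < u) /\
   (forall i k : 'I_n.+1, i \in S -> k \in S -> i < k -> b k <= i))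
  (S \in spaced u).
Proof.
rewrite inE; apply: (iffP forall_inP) => [H|[H1 H2] k kS].
  split=> [k /H /andP[] //|i k iS kS ik].
  by have /andP[_ /forall_inP /(_ i iS) /implyP /(_ ik)] := H k kS.
rewrite H1 //=; apply/forall_inP => i iS; apply/implyP; exact: H2.
Qed.

Lemma in_spaced_card u k S :
  (S \in [set S in spaced u | #|S| == k]%SET) = (S \in spaced u) && (#|S| == k).
Proof. by rewrite finset.in_set. Qed.

Lemma card_spaced0 u : #|[set S in spaced u | #|S| == 0]%SET| = 1.
Proof.
rewrite -(cards1 (finset.set0 : {set 'I_n.+1})); congr #|pred_of_set _|.
apply/setP => S; rewrite in_spaced_card finset.in_set1 cards_eq0.
have [->|] := eqVneq S finset.set0; last by rewrite andbF.
by rewrite andbT; apply/spacedP; split=> [k|i k]; rewrite inE.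
Qed.

(** The largest element [m] of such a set can be followed below by any [k] of the
[m - b m] allowed elements: as [b] is monotone, the conditions between smaller
elements then hold by themselves. *)
Lemma card_spaced u k : l <= u <= n.+1 -> (forall m, l <= m < u -> l <= b m <= m) ->
  #|[set S in spaced u | #|S| == k.+1]%SET| = \sum_(l <= m < u) 'C(m - b m, k).
Proof.
move=> /andP[lu un]; have [q uE] : exists q, u = l + q by exists (u - l); lia.
move: un; rewrite uE {u lu uE}; elim: q => [|q IH] lqn bl.
  rewrite addn0 [RHS]big_geq //; apply/eqP; rewrite cards_eq0 -finset.subset0.
  apply/fintype.subsetP => S; rewrite in_spaced_card => /andP[/spacedP [H _] /eqP cS].
  have [i iS] : exists i, i \in S by apply/set0Pn; rewrite -cards_eq0 cS.
  by have := H i iS; lia.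
have lq : l + q < n.+1 by lia.
pose o := Ordinal lq.
pose W := [set i : 'I_n.+1 | b (l + q) <= i < b (l + q) + (l + q - b (l + q))]%SET.
have blq : l <= b (l + q) <= l + q by apply: bl; lia.
have cW : #|W| = l + q - b (l + q) by apply: card_window; lia.
have oW (S : {set 'I_n.+1}) : S \subset W -> o \notin S.
  by move=> /fintype.subsetP H; apply/negP => /H; rewrite inE /=; lia.
have -> : [set S in spaced (l + q.+1) | #|S| == k.+1]%SET =
    [set S in spaced (l + q) | #|S| == k.+1]%SET :|:
    [set (o |: S)%SET | S in [set S : {set 'I_n.+1} | S \subset W & #|S| == k]]%SET.
  apply/setP => S; rewrite finset.in_setU !in_spaced_card.
  apply/andP/orP => [[/spacedP [S1 S2] cS]|[/andP[/spacedP [S1 S2] cS]|]].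
  - have [oS|oS] := boolP (o \in S).
      right; apply/imsetP; exists (S :\ o)%SET; last by rewrite finset.setD1K.
      rewrite finset.in_set; apply/andP; split; last first.
        by move: cS; rewrite (cardsD1 o S) oS.
      apply/fintype.subsetP => i; rewrite !inE => /andP[io iS].
      have := S1 i iS; have ilt : i < o.
        rewrite /=; have := S1 i iS; move: io; rewrite -val_eqE /=; lia.
      by have /= := S2 _ _ iS oS ilt; move: ilt => /=; lia.
    left; rewrite cS andbT; apply/spacedP; split => // i iS.
    have : i != o by apply: contraNneq oS => <-.
    by have := S1 i iS; rewrite -val_eqE /=; lia.
  - by split => //; apply/spacedP; split => // i /S1; lia.
  - move=> /imsetP [S']; rewrite finset.in_set => /andP[SW /eqP cS] ->.
    have oS := oW _ SW; split; last by rewrite cardsU1 oS cS.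
    have S'W i : i \in S' -> b (l + q) <= i < l + q.
      by move=> /(fintype.subsetP SW); rewrite inE; lia.
    apply/spacedP; split=> [i|i i']; rewrite !inE.
      by move=> /orP[/eqP ->|/S'W] /=; lia.
    move=> /orP[/eqP ->|iS] /orP[/eqP ->|i'S] /=.
    + by rewrite ltnn.
    + by have := S'W _ i'S; lia.
    + by have := S'W _ iS; lia.
    have h : i' <= l + q by have := S'W _ i'S; lia.
    by have := b_mono h; have := S'W _ iS; lia.
rewrite addnS big_nat_recr /=; last by lia.
rewrite -IH; [|lia|by move=> m ?; apply: bl; lia].
rewrite cardsU (_ : _ :&: _ = finset.set0) ?cards0 ?subn0.
  congr (_ + _); rewrite card_in_imset ?cards_draws ?cW // => S S'.
  rewrite !finset.in_set => /andP[/oW oS _] /andP[/oW oS' _] E.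
  by rewrite -(finset.setU1K oS) -(finset.setU1K oS') E.
apply/setP => S; rewrite finset.in_setI in_spaced_card [RHS]finset.in_set; apply/negP.
move=> /andP[/andP[/spacedP [S1 _] _]].
move=> /imsetP [S' _ SE]; have := S1 o; rewrite SE !inE eqxx /= => /(_ isT); lia.
Qed.

End SpacedSets.

Section BinomialSums.
Local Open Scope nat_scope.

Lemma sum_hockey l q k : \sum_(l <= m < l + q) 'C(m - l, k) = 'C(q, k.+1).
Proof.
elim: q => [|q IH]; first by rewrite addn0 big_geq.
by rewrite addnS big_nat_recr ?leq_addr //= IH addKn binS.
Qed.

End BinomialSums.

Section FaceCount.
Variables (n d : nat).
Hypotheses (d3 : (3 <= d)%N) (dn : (d <= n)%N).
Local Open Scope nat_scope.
Implicit Types (X S J : {set 'I_n.+1}).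

(** The bounds that describe short faces avoiding [x_0], short faces through [x_0],
and clustered sets. In the second one, the windows at the two ends, which come
from [T_0] and [E_n], have one element more than those in between. *)
Definition gap_avoid m := maxn 1 (m - d.-1).
Definition gap_apex m := if m < d then 1 else if m < n then m - (d - 3) else n - (d - 2).
Definition gap_removed m := maxn 2 (m - (d - 3)).

Lemma gap_apexP m : [\/ m < d /\ gap_apex m = 1, [/\ d <= m, m < n & gap_apex m = m - (d - 3)] |
  n <= m /\ gap_apex m = n - (d - 2)].
Proof.
rewrite /gap_apex; case: (ltnP m d) => H; first by constructor 1.
by case: (ltnP m n) => H'; [constructor 2 | constructor 3].
Qed.

Lemma gap_avoid_mono i k : i <= k -> gap_avoid i <= gap_avoid k.
Proof. rewrite /gap_avoid; lia. Qed.

Lemma gap_apex_mono i k : i <= k -> gap_apex i <= gap_apex k.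
Proof.
by move=> ik; case: (gap_apexP i) => [[? ->]|[? ? ->]|[? ->]];
  case: (gap_apexP k) => [[? ->]|[? ? ->]|[? ->]]; lia.
Qed.

Lemma gap_removed_mono i k : i <= k -> gap_removed i <= gap_removed k.
Proof. rewrite /gap_removed; lia. Qed.

Lemma set_max X : X = finset.set0 \/ exists2 M, M \in X & forall i, i \in X -> i <= M.
Proof.
have [->|[i iX]] := finset.set_0Vmem X; [by left | right].
have [M MX H] := arg_maxnP (fun k : 'I_n.+1 => k : nat) iX.
by exists M => // k /H.
Qed.

Lemma short_gap_avoid X : ord0 \notin X -> short d X <-> X \in spaced n 1 gap_avoid n.+1.
Proof.
move=> X0.
have pos k : k \in X -> 0 < k.
  move=> kX; rewrite lt0n; apply: contraNneq X0 => k0.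
  by rewrite (_ : ord0 = k) //; apply: val_inj.
split=> [sX|/spacedP [X1 X2]].
  apply/spacedP; split=> [k /pos|i k iX kX ik]; first by have := ltn_ord k; lia.
  have := pos i iX; have := ltn_ord k; rewrite /gap_avoid.
  by case: sX => [[s sd] /fintype.subsetP H|/fintype.subsetP H|[t tn] /fintype.subsetP H];
    move: (H _ iX) (H _ kX); rewrite !inE; lia.
have [->|[M MX HM]] := set_max X.
  by constructor 2; exact: finset.sub0set.
have Mn := ltn_ord M.
constructor 1; exists (M.+1 - d); first by lia.
apply/fintype.subsetP => i iX; rewrite inE; have := HM i iX.
have [iM|iM] := ltnP i M; last by lia.
have := X2 i M iX MX iM; rewrite /gap_avoid; lia.
Qed.

Lemma short_gap_apex S : ord0 \notin S -> short d (ord0 |: S) <-> S \in spaced n 1 gap_apex n.+1.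
Proof.
move=> S0.
have pos k : k \in S -> 0 < k.
  move=> kX; rewrite lt0n; apply: contraNneq S0 => k0.
  by rewrite (_ : ord0 = k) //; apply: val_inj.
have inU k : k \in S -> k \in ord0 |: S by move=> kS; rewrite !inE kS orbT.
split=> [sX|/spacedP [X1 X2]].
  apply/spacedP; split=> [k /pos|i k iX kX ik]; first by have := ltn_ord k; lia.
  have := pos i iX; have := ltn_ord k.
  by case: sX => [[s sd] /fintype.subsetP H|/fintype.subsetP H|[t tn] /fintype.subsetP H];
    move: (H _ (inU _ iX)) (H _ (inU _ kX)) (H ord0); rewrite !inE /=;
    case: (gap_apexP k) => [[? ->]|[? ? ->]|[? ->]]; lia.
have sub (Y : {set 'I_n.+1}) : ord0 \in Y -> (forall i, i \in S -> i \in Y) -> ord0 |: S \subset Y.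
  move=> Y0 SY; apply/fintype.subsetP => i; rewrite !inE => /orP[/eqP -> //|]; exact: SY.
have [SE|[M MX HM]] := set_max S.
  constructor 1; exists 0; first by lia.
  by apply: sub => [|i]; rewrite ?SE inE //=; lia.
have Mn := ltn_ord M.
have low i : i \in S -> i = M :> nat \/ gap_apex M <= i < M.
  move=> iS; have := HM i iS; have [iM|iM] := ltnP i M; last by left; lia.
  by have := X2 i M iS MX iM; right; lia.
case: (gap_apexP M) low => [[M1 ->]|[M1 M2 ->]|[M1 ->]] low.
- constructor 1; exists 0; first by lia.
  by apply: sub => [|i /low]; rewrite inE /=; lia.
- have [M3|M3] := leqP n M.+1.
    by constructor 2; apply: sub => [|i /low]; rewrite inE /=; lia.
  constructor 3; exists (M - (d - 2)); first by lia.
  by apply: sub => [|i /low]; rewrite inE /=; lia.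
- by constructor 2; apply: sub => [|i /low]; rewrite inE /=; lia.
Qed.

Lemma clustered_gap_removed J : clustered d J <-> J \in spaced n 2 gap_removed n.
Proof.
split=> [[J1 J2]|/spacedP [J1 J2]].
  apply/spacedP; split=> [k /J1 //|i k iJ kJ ik].
  by have := J1 i iJ; have := J2 _ _ kJ iJ; rewrite /gap_removed; lia.
split=> // s t sJ tJ; have [st|st] := leqP s t; first by lia.
by have := J2 _ _ tJ sJ st; rewrite /gap_removed; lia.
Qed.

Lemma card_gap_avoid k : #|[set S in spaced n 1 gap_avoid n.+1 | #|S| == k.+1]%SET| =
  'C(d, k.+1) + (n - d) * 'C(d.-1, k).
Proof.
rewrite card_spaced; [|exact: gap_avoid_mono | by lia | by move=> m; rewrite /gap_avoid; lia].
rewrite (@big_cat_nat _ _ _ (1 + d)) /=; [|by lia|by lia].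
congr (_ + _).
  rewrite -(sum_hockey 1); apply: eq_big_nat => m ?; congr 'C(_, _).
  by rewrite /gap_avoid; lia.
rewrite (eq_big_nat _ _ (F2 := fun=> 'C(d.-1, k))) ?sum_nat_const_nat; first by congr (_ * _); lia.
by move=> m ?; congr 'C(_, _); rewrite /gap_avoid; lia.
Qed.

Lemma card_gap_apex k : #|[set S in spaced n 1 gap_apex n.+1 | #|S| == k.+1]%SET| =
  'C(d.-1, k.+1) + (n - d) * 'C(d - 3, k) + 'C(d - 2, k).
Proof.
rewrite card_spaced; [|exact: gap_apex_mono | by lia |]; last first.
  by move=> m ?; case: (gap_apexP m) => [[? ->]|[? ? ->]|[? ->]]; lia.
rewrite big_nat_recr /=; last by lia.
congr (_ + _); last first.
  by congr 'C(_, _); case: (gap_apexP n) => [[? ->]|[? ? ->]|[? ->]]; lia.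
rewrite (@big_cat_nat _ _ _ (1 + d.-1)) /=; [|by lia|by lia].
congr (_ + _).
  rewrite -(sum_hockey 1); apply: eq_big_nat => m ?; congr 'C(_, _).
  by case: (gap_apexP m) => [[? ->]|[? ? ->]|[? ->]]; lia.
rewrite (eq_big_nat _ _ (F2 := fun=> 'C(d - 3, k))) ?sum_nat_const_nat; first by congr (_ * _); lia.
by move=> m ?; congr 'C(_, _); case: (gap_apexP m) => [[? ->]|[? ? ->]|[? ->]]; lia.
Qed.

Lemma card_gap_removed k : #|[set S in spaced n 2 gap_removed n | #|S| == k.+1]%SET| =
  'C(d - 2, k.+1) + (n - d) * 'C(d - 3, k).
Proof.
rewrite card_spaced; [|exact: gap_removed_mono | by lia | by move=> m; rewrite /gap_removed; lia].
rewrite (@big_cat_nat _ _ _ (2 + (d - 2))) /=; [|by lia|by lia].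
congr (_ + _).
  rewrite -(sum_hockey 2); apply: eq_big_nat => m ?; congr 'C(_, _).
  by rewrite /gap_removed; lia.
rewrite (eq_big_nat _ _ (F2 := fun=> 'C(d - 3, k))) ?sum_nat_const_nat; first by congr (_ * _); lia.
by move=> m ?; congr 'C(_, _); rewrite /gap_removed; lia.
Qed.

End FaceCount.

Lemma lift1_neq0 (R : realType) (m : nat) (y : 'rV[R]_m) : lift1 y != 0.
Proof. by apply: contraNneq (lift1_notin_emb y 0) => ->; rewrite mem0v. Qed.

Lemma rk_set1 (R : realType) (m : nat) (I : finType) (x : I -> 'rV[R]_m) i :
  rk x [set i]%SET = 1%N.
Proof. by rewrite /rk /hspan big_set1 dim_vline lift1_neq0. Qed.

Section FaceNumbers.
Variables (R : realType) (m n d : nat) (x : 'I_n.+1 -> 'rV[R]_m).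
Hypotheses (d3 : (3 <= d)%N) (dn : (d <= n)%N).
Hypotheses (cpx : convex_position x) (rT : rk x [set: 'I_n.+1]%SET = d.+1).
Hypothesis facetP : forall X,
  exposed x [set: 'I_n.+1]%SET X /\ rk x X = d <-> brax_facet d X.
Implicit Types (X J S : {set 'I_n.+1}).
Local Notation T := [set: 'I_n.+1]%SET.

Definition faces_avoid k : {set {set 'I_n.+1}} :=
  [set S in spaced n 1 (gap_avoid d) n.+1 | #|S| == k]%SET.
Definition faces_apex k : {set {set 'I_n.+1}} :=
  if k is k'.+1 then
    [set (ord0 |: S)%SET | S in [set S in spaced n 1 (gap_apex n d) n.+1 | #|S| == k']%SET]%SET
  else finset.set0.
Definition faces_gapped k : {set {set 'I_n.+1}} :=
  [set gapped d J | J in [set J in spaced n 2 (gap_removed d) n | #|J| == (d.+1 - k)%N]%SET]%SET.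

Lemma spaced_ord0 b u S : S \in spaced n 1 b u -> ord0 \notin S.
Proof. by move=> /spacedP [H _]; apply/negP => /H. Qed.

Lemma faces_classes k X : (k <= d.+1)%N ->
  X \in (faces_avoid k :|: faces_apex k :|: faces_gapped k)%SET <-> exposed x T X /\ rk x X = k.
Proof.
move=> kd; rewrite !finset.in_setU; split.
  case/orP=> [/orP[|]|].
  - rewrite in_spaced_card => /andP[sX /eqP cX].
    have /(short_gap_avoid d3 dn (spaced_ord0 sX)) sX' := sX.
    have [iX eX] := short_exposed d3 dn rT facetP sX'.
    by split => //; rewrite (eqP iX).
  - case: k kd => [|k] kd; first by rewrite inE.
    move=> /imsetP [S]; rewrite in_spaced_card => /andP[sS /eqP cS] ->.
    have S0 := spaced_ord0 sS.
    have /(short_gap_apex d3 dn S0) sX := sS.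
    have [iX eX] := short_exposed d3 dn rT facetP sX.
    by split => //; rewrite (eqP iX) cardsU1 S0 cS.
  - move=> /imsetP [J]; rewrite in_spaced_card => /andP[/(clustered_gap_removed d3 dn) cJ /eqP cardJ] ->.
    split; first exact: gapped_exposed d3 dn rT facetP _ cJ.
    by have := gapped_rk d3 dn rT facetP cJ; rewrite cardJ; lia.
move=> [eX rX].
have [sX|[J cJ XE]] := exposed_shape d3 dn rT facetP eX.
  have [iX _] := short_exposed d3 dn rT facetP sX.
  have cX : #|X| = k by rewrite -(eqP iX).
  have [X0|X0] := boolP (ord0 \in X); last first.
    by rewrite in_spaced_card cX eqxx andbT ((short_gap_avoid d3 dn X0).1 sX).
  apply/orP; left; apply/orP; right.
  have XE : X = (ord0 |: X :\ ord0)%SET by rewrite finset.setD1K.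
  have nX0 : ord0 \notin (X :\ ord0)%SET by rewrite !inE eqxx.
  case: k kd rX cX => [|k] kd rX cX.
    by move: cX => /cards0_eq cX; move: X0; rewrite cX inE.
  apply/imsetP; exists (X :\ ord0)%SET => //; rewrite in_spaced_card.
  rewrite XE in sX; rewrite ((short_gap_apex d3 dn nX0).1 sX) /=.
  by move: cX; rewrite (cardsD1 ord0) X0 add1n => -[->].
apply/orP; right; apply/imsetP; exists J => //; rewrite in_spaced_card.
rewrite ((clustered_gap_removed d3 dn J).1 cJ) /=.
by have := gapped_rk d3 dn rT facetP cJ; rewrite -XE rX => <-; rewrite addKn.
Qed.

Lemma gapped_ord0 J : ord0 \in gapped d J.
Proof. by apply/in_gapped; left. Qed.

Lemma card_classes k : (#|faces_avoid k :|: faces_apex k :|: faces_gapped k|)%SET =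
  (#|faces_avoid k| + #|faces_apex k| + #|faces_gapped k|)%N.
Proof.
have AB : (faces_avoid k :&: faces_apex k)%SET = finset.set0.
  apply/setP => X; rewrite finset.in_setI [RHS]finset.in_set0; apply/negP => /andP[].
  rewrite in_spaced_card => /andP[/spaced_ord0 X0 _].
  case: k => [|k]; first by rewrite inE.
  by move=> /imsetP [S _ XE]; move: X0; rewrite XE !inE eqxx.
have ABC : ((faces_avoid k :|: faces_apex k) :&: faces_gapped k)%SET = finset.set0.
  apply/setP => X; rewrite finset.in_setI [RHS]finset.in_set0; apply/negP => /andP[+ /imsetP [J]].
  rewrite finset.in_setU => XAB; rewrite in_spaced_card => /andP[/(clustered_gap_removed d3 dn) cJ _] XE.
  apply: (gapped_not_short d3 dn cJ); rewrite -XE.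
  case/orP: XAB.
    by rewrite in_spaced_card => /andP[/spaced_ord0]; rewrite XE gapped_ord0.
  clear AB; case: k => [|k]; first by rewrite inE.
  move=> /imsetP [S]; rewrite in_spaced_card => /andP[sS _] ->.
  by apply/(short_gap_apex d3 dn (spaced_ord0 sS)).
rewrite cardsU ABC cards0 subn0; congr (_ + _)%N.
by rewrite cardsU AB cards0 subn0.
Qed.

Lemma card_faces_apex k :
  #|faces_apex k.+1| = #|[set S in spaced n 1 (gap_apex n d) n.+1 | #|S| == k]%SET|.
Proof.
rewrite card_in_imset // => S S'; rewrite !in_spaced_card.
move=> /andP[/spaced_ord0 S0 _] /andP[/spaced_ord0 S'0 _] E.
by rewrite -(finset.setU1K S0) -(finset.setU1K S'0) E.
Qed.

Lemma card_faces_gapped k :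
  #|faces_gapped k| = #|[set J in spaced n 2 (gap_removed d) n | #|J| == (d.+1 - k)%N]%SET|.
Proof.
rewrite card_in_imset // => J J'; rewrite !in_spaced_card.
move=> /andP[/(clustered_gap_removed d3 dn) cJ _].
by move=> /andP[/(clustered_gap_removed d3 dn) cJ' _] /(gapped_inj d3 dn cJ cJ').
Qed.

(** Pascal's rule combines the three counts. Ranks below 3 are separate because
lower binomial indices would become negative, and the rank [d + 1] because it
comes from the empty set [J]. *)
Lemma fnum_braxtope (j : int) : -1 <= j <= d%:Z ->
  fnum (hull x T) j = (binz (d + 1) (j + 1) +
          (n - d) * (binz (d - 1) j + binz (d - 2) (j - 1)))%N.
Proof.
move=> jd; have [k [jE kd]] : exists k : nat, j = k%:Z - 1 /\ (k <= d.+1)%N.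
  by exists (absz (j + 1)); lia.
pose A := (faces_avoid k :|: faces_apex k :|: faces_gapped k)%SET.
rewrite jE (@fnum_hull _ _ _ _ cpx T k A); last first.
  by move=> X; exact: faces_classes.
rewrite {}/A card_classes card_faces_gapped.
have -> : k%:Z - 1 + 1 = k%:Z by lia.
have e1 : (d - 1 = d.-1)%N by lia.
have e2 : (d + 1 = d.+1)%N by lia.
rewrite e1 e2.
case: k jE kd => [|[|[|k]]] jE kd.
- rewrite /faces_avoid card_spaced0 cards0 subn0.
  rewrite card_gap_removed // !bin_small /=; [|lia|lia].
  by rewrite muln0 bin0; lia.
- have -> : 1%:Z - 1 = 0%:Z by [].
  rewrite /faces_avoid card_gap_avoid // card_faces_apex card_spaced0.
  have -> : (d.+1 - 1 = d.-1.+1)%N by lia.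
  rewrite card_gap_removed // !(@bin_small (d - 2)) ?(@bin_small (d - 3)) /=; [|lia|lia].
  by rewrite /= !bin0 !bin1; lia.
- have -> : 2%:Z - 1 = 1%:Z by [].
  have -> : 1%:Z - 1 = 0%:Z by [].
  rewrite /faces_avoid card_gap_avoid // card_faces_apex card_gap_apex //.
  have -> : (d.+1 - 2 = (d - 2).+1)%N by lia.
  rewrite card_gap_removed // !(@bin_small (d - 2)%N (d - 2).+1)
    ?(@bin_small (d - 3)%N (d - 2)%N) //; [|lia].
  by rewrite /= !bin0 !bin1 binS bin1; lia.
rewrite /faces_avoid card_gap_avoid // card_faces_apex card_gap_apex //.
have -> : k.+3%:Z - 1 = k.+2%:Z by lia.
have -> : k.+2%:Z - 1 = k.+1%:Z by lia.
rewrite /=.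
have [kd'|kd'] := eqVneq k.+2 d.
  have -> : (d.+1 - k.+3 = 0)%N by lia.
  by rewrite card_spaced0 -kd' /= binn !bin_small //; lia.
have -> : (d.+1 - k.+3 = (d - k.+3).+1)%N by lia.
rewrite card_gap_removed //.
have -> : 'C(d - 2, (d - k.+3).+1) = 'C(d - 2, k).
  by rewrite -[RHS]bin_sub; [congr 'C(_, _); lia | lia].
have -> : 'C(d - 3, d - k.+3) = 'C(d - 3, k).
  by rewrite -[RHS]bin_sub; [congr 'C(_, _); lia | lia].
have [d' dE] : exists d', d = d'.+3 by exists (d - 3)%N; lia.
rewrite dE /=; have -> : (d'.+3 - 2 = d'.+1)%N by lia.
have -> : (d'.+3 - 3 = d')%N by lia.
have H1 := binS d'.+3 k.+2; have H2 := binS d'.+2 k.+1.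
have H3 := binS d'.+1 k; have H4 := binS d' k.
rewrite H1 H2 H3 [X in (_ + (_ * (_ + X)))%N]H4 !mulnDr; lia.
Qed.

End FaceNumbers.

(** Each triangle has three vertices, so flags of a vertex in a 2-face number three
times the 2-faces. *)
Lemma elementary_hull (R : realType) (m n d : nat) (x : 'I_n.+1 -> 'rV[R]_m)
    (T := [set: 'I_n.+1]%SET) :
  (3 <= d <= n)%N -> convex_position x ->
  (forall X, exposed x T X -> rk x X = 3 -> #|X| = 3) ->
  fnum (hull x T) 0 = n.+1 -> fnum (hull x T) 1 = ('C(d.+1, 2) + (n - d) * d)%N ->
  elementary d (hull x T).
Proof.
move=> /andP[d3 dn] cpx tri f0 f1.
pose A3 := [set X : {set 'I_n.+1} | `[< exposed x T X /\ rk x X = 3 >]]%SET.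
have A3P X : X \in A3 <-> exposed x T X /\ rk x X = 3.
  by rewrite finset.in_set; split=> [/asboolP|H] //; apply/asboolP.
have f2 : fnum (hull x T) 2 = #|A3| by rewrite -(fnum_hull cpx A3P).
have f02 : fnum02 (hull x T) = (#|A3| * 3)%N.
  pose D := [set u : {set 'I_n.+1} * 'I_n.+1 | (u.1 \in A3) && (u.2 \in u.1)]%SET.
  transitivity #|D|; last first.
    rewrite -sum1_card (eq_bigl (fun u => (u.1 \in A3) && (u.2 \in u.1))); last first.
      by move=> u; rewrite finset.in_set.
    rewrite -(pair_big_dep (mem A3) (fun X i => i \in X) (fun _ _ => 1%N)) /=.
    rewrite -sum_nat_const; apply: eq_bigr => X /A3P [eX rX].
    by rewrite sum1_card; exact: tri.
  apply: (@card_fset_set_image _ _ (fun u => (hull x [set u.2]%SET, hull x u.1))).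
    by move=> [X i] [Y k] _ _ /= [/(hull_inj cpx) /finset.set1_inj -> /(hull_inj cpx) ->].
  move=> [F G]; split=> /= [[F0 G2 FG]|[[X i]]]; last first.
    rewrite finset.in_set /= => /andP[/A3P [eX rX] iX] [-> ->]; split.
    - have -> : 0 = 1%:Z - 1 by [].
      by apply/(faces_hull_mem cpx); split; [exact: cpx | exact: rk_set1].
    - have -> : 2 = 3%:Z - 1 by [].
      by apply/(faces_hull_mem cpx).
    - by apply: hullS; rewrite finset.sub1set.
  have : faces (hull x T) (3%:Z - 1) G by [].
  move=> /faces_hull [X [eX rX GE]].
  have : faces (hull x T) (1%:Z - 1) F by [].
  move=> /faces_hull [Y [eY rY FE]].
  have [Y0|[i iY]] := finset.set_0Vmem Y; first by move: rY; rewrite Y0 rk0.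
  have YE : Y = [set i]%SET.
    apply/eqP; apply: contraPT rY => neY.
    have : (rk x [set i]%SET < rk x Y)%N.
      apply: rk_lt; last by rewrite eq_sym.
      by apply: exposed_restrict (cpx i); rewrite ?finset.sub1set ?finset.subsetT.
    by rewrite rk_set1 => /[swap] ->.
  exists (X, i); last by rewrite FE GE YE.
  rewrite finset.in_set /=; apply/andP; split; first exact/A3P.
  by apply/(hull_mem cpx); rewrite -GE; apply: FG; rewrite FE YE hull1.
rewrite /elementary f02 f2 f0 f1.
have := mul_bin_diag d.+1 1; rewrite /= bin1.
by nia.
Qed.

(** * Iterated pyramids *)

(** The set [E_(d-1)] omits only the index [d - 1], which is thus an apex. Passing
to [E_(d-1)] lowers [n] and [d] by one, hence [2d - 2 - n] by one. *)
Lemma braxtope_pyramid (R : realType) (m : nat) (r d n : nat) (xs : seq 'rV[R]_m) Q :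
  (2 <= d <= n)%N -> (n + r = 2 * d - 2)%N -> size xs = n.+1 -> braxtope d%:Z xs Q ->
  exists ys : seq 'rV[R]_m,
          [/\ subseq ys xs,
              braxtope (n%:Z - d%:Z + 2) ys (conv [set` ys]) &
              fold_pyramid r (conv [set` ys]) Q].
Proof.
elim: r d n xs Q => [|r IH] d n xs Q /andP[d2 dn] nr sn bQ.
  have QE : Q = conv [set` xs].
    by have [va _] := bQ; have [_ ->] := (vertex_arrayP _ sn).1 va; rewrite hull_vtx.
  exists xs; split => //; rewrite -QE //.
  by have -> : n%:Z - d%:Z + 2 = d%:Z by lia.
have d3 : (3 <= d)%N by lia.
have [cpx QE rT _ facetP] := (braxtopeP Q sn d3).1 bQ.
set x := vtx xs (N:=n.+1) in cpx QE rT facetP.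
have jn : (d.-1 < n.+1)%N by lia.
pose o := Ordinal jn; pose X := Eset n d d.-1.
have XE : X = ([set: 'I_n.+1] :\ o)%SET.
  by apply/setP => k; rewrite !inE -val_eqE /=; have := ltn_ord k; lia.
have bX : brax_facet d X by right; exists d.-1 => //; lia.
have bX' := facet_braxtope sn d3 dn cpx rT facetP bX.
have [eX rX] := (facetP X).2 bX.
have cX : #|X| = n.
  by have := cardsD1 o [set: 'I_n.+1]%SET; rewrite -XE cardsT card_ord finset.in_setT add1n => -[].
have dE : d%:Z - 1 = d.-1%:Z by lia.
rewrite dE in bX'.
have [|||ys [ys1 ys2 ys3]] := IH d.-1 n.-1 _ _ _ _ _ bX'; try lia.
  by rewrite induced_hull // size_map -cardE cX; lia.
exists ys; split.
- by apply: subseq_trans ys1 _; exact: filter_subseq.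
- by have -> : n%:Z - d%:Z + 2 = n.-1%:Z - d.-1%:Z + 2 by lia.
exists (hull x X) => //; exists (x o).
  move=> /aff_hull; apply/negP.
  by apply: exposed_notin_hspan eX _ _; rewrite ?XE !inE ?eqxx.
rewrite QE; apply/seteqP; split.
  move=> p [k [q [w [Aq w0 w1 ->]]]]; exists k, q, w; split => // i.
  have [l _ <-] := Aq i; have [->|lo] := eqVneq l o; first by right.
  by left; apply: mem_hull; rewrite XE !inE lo.
apply: conv_sub_hull => p [|->]; last by apply: mem_hull; rewrite inE.
by apply: hullS; exact: finset.subsetT.
Qed.

(** * Vertex figures *)

Section VertexFigure.
Variables (R : realType) (m : nat) (I : finType) (x : I -> 'rV[R]_m) (o : I).
Variables (c : 'rV[R]_m) (b : R).
Hypotheses (co : dot c (x o) < b) (ci : forall i, i != o -> b < dot c (x i)).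
Local Notation T := [set: I]%SET.
Implicit Types X G : {set I}.

Let h i := dot c (x i) - b.

(** For [i] other than [o], the point where the segment from [x o] to [x i] meets the
hyperplane. *)
Definition cut i := (h i / (h i - h o)) *: x o + (- h o / (h i - h o)) *: x i.
Local Notation y := cut.

Let ho : h o < 0. Proof. by rewrite subr_lt0. Qed.
Let hi i : i != o -> 0 < h i. Proof. by move=> /ci; rewrite subr_gt0. Qed.
Let hio i : i != o -> h i - h o != 0.
Proof. by move=> /hi; have := ho => ? ?; rewrite gt_eqF //; lra. Qed.

Lemma cut_coef i : i != o -> h i / (h i - h o) + (- h o / (h i - h o)) = 1.
Proof. by move=> io; rewrite -mulrDl divff ?hio. Qed.

Lemma cut_coef_gt0 i : i != o -> 0 < - h o / (h i - h o).
Proof.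
move=> io; have := hi io; have := ho => ? ?.
by rewrite divr_gt0 ?oppr_gt0 //; lra.
Qed.

Lemma lift1_aff2 (a1 a2 : R) (u v : 'rV[R]_m) : a1 + a2 = 1 ->
  lift1 (a1 *: u + a2 *: v) = a1 *: lift1 u + a2 *: lift1 v.
Proof.
move=> a12; rewrite /lift1 !scale_row_mx add_row_mx !scale_scalar_mx !mulr1.
by congr row_mx; rewrite -a12 raddfD.
Qed.

Lemma ev_cut g i : i != o ->
  ev g (y i) = h i / (h i - h o) * ev g (x o) + (- h o / (h i - h o)) * ev g (x i).
Proof. by move=> io; rewrite /ev lift1_aff2 ?cut_coef // dotDr !dotZr. Qed.

Lemma dot_cut i : i != o -> dot c (y i) = b.
Proof.
move=> io; have [g gE] := affine_ev c b.
have : ev g (y i) = 0.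
  by rewrite ev_cut // !gE -!/(h _); field; exact: hio.
by rewrite gE => /subr0_eq.
Qed.

(** If [p] is the combination with weights [w i], rescale them by
[(h i - h o) / (- h o)]: the coefficients of [x o] cancel because the [w i]
average [h] to zero on the hyperplane. *)
Lemma hull_cut X : o \notin X ->
  hull x (o |: X)%SET `&` hyperplane c b = hull y X.
Proof.
move=> oX; have no i : i \in X -> i != o by move=> iX; apply: contraNneq oX => <-.
have [g gE] := affine_ev c b.
apply/seteqP; split=> [p [/hullP [w [w0 wX w1 pE]] /= cp]|p yp].
  have wh : \sum_i w i * h i = 0.
    have gp : ev g p = 0 by rewrite gE cp subrr.
    by rewrite -[RHS]gp pE ev_comb //; apply: eq_bigr => i _; rewrite gE.
  apply/hullP; exists (fun i => w i * ((h i - h o) / - h o)); split.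
  - move=> i; have [->|io] := eqVneq i o; first by rewrite subrr mul0r mulr0.
    have := hi io; have := ho => ? ?.
    by rewrite mulr_ge0 // divr_ge0 ?oppr_ge0 ?(ltW ho) //; lra.
  - move=> i iX; have [->|io] := eqVneq i o; first by rewrite subrr mul0r mulr0.
    by rewrite wX ?mul0r // !inE negb_or io.
  - transitivity ((\sum_i w i * h i) / - h o + \sum_i w i); last by rewrite wh w1 mul0r add0r.
    rewrite big_distrl -big_split; apply: eq_bigr => i _ /=.
    by field; rewrite lt_eqF.
  transitivity (((\sum_i w i * h i) / - h o) *: x o + \sum_i w i *: x i).
    by rewrite wh mul0r scale0r add0r.
  rewrite big_distrl scaler_suml -big_split; apply: eq_bigr => i _ /=.
  rewrite /y scalerDr !scalerA; have [->|io] := eqVneq i o.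
    rewrite subrr !(invr0, mulr0, mul0r, scale0r) addr0 -scalerDl invrN mulrN -mulrA.
    by rewrite divff ?lt_eqF // mulr1 addNr scale0r.
  by congr (_ *: _ + _ *: _); field; rewrite hio // lt_eqF.
split.
  move: p yp; apply: conv_sub_hull => _ [i iX <-].
  have io := no i iX.
  apply/hullP; exists (fun k => if k == o then h i / (h i - h o) else
     if k == i then - h o / (h i - h o) else 0); split.
  - move=> k; case: eqP => _.
      by have := hi io; have := ho => ? ?; rewrite divr_ge0 //; lra.
    by case: eqP => _ //; exact/ltW/cut_coef_gt0.
  - move=> k; rewrite !inE negb_or => /andP[/negPf -> kX].
    by case: eqP kX => // ->; rewrite (iX : i \in X).
  - rewrite (bigD1 o) //= eqxx (bigD1 i) //= (negPf io) eqxx big1 ?addr0 ?cut_coef //.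
    by move=> k /andP[/negPf -> /negPf ->].
  rewrite (bigD1 o) //= eqxx (bigD1 i) //= (negPf io) eqxx big1 ?addr0 //.
  by move=> k /andP[/negPf -> /negPf ->]; rewrite scale0r.
move: yp => /hullP [w [w0 wX w1 pE]].
have : ev g p = 0.
  rewrite pE ev_comb // big1 // => i _.
  have [iX|/wX ->] := boolP (i \in X); last by rewrite mul0r.
  by rewrite gE dot_cut ?no // subrr mulr0.
by rewrite gE => /subr0_eq.
Qed.

(** Each [x i] is on the line through [x o] and [cut i], and [x o] is off the
hyperplane that contains all the cuts. *)
Lemma rk_cut G : o \in G -> rk x G = (rk y (G :\ o)%SET).+1.
Proof.
move=> oG; have no i : i \in (G :\ o)%SET -> i != o by rewrite !inE => /andP[].
have [g gE] := affine_ev c b.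
have xo : lift1 (x o) \notin hspan y (G :\ o)%SET.
  apply/negP => /memv_sumP [v vX E].
  have : ev g (x o) = 0.
    rewrite /ev E dot_sumr big1 // => i iG.
    have /vlineP [a ->] := vX i iG; rewrite dotZr.
    have -> : dot g (lift1 (y i)) = 0; last by rewrite mulr0.
    by rewrite -/(ev g (y i)) gE dot_cut ?no ?subrr.
  by rewrite gE; move: co => /[swap] /subr0_eq ->; rewrite ltxx.
rewrite /rk -(dim_add_line xo); congr (\dim _); apply/eqP; rewrite eqEsubv.
have yE i : i != o -> lift1 (y i) = (h i / (h i - h o)) *: lift1 (x o)
    + (- h o / (h i - h o)) *: lift1 (x i).
  by move=> io; rewrite lift1_aff2 ?cut_coef.
apply/andP; split.
  apply: hspan_sub => i iG; have [->|io] := eqVneq i o.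
    by apply: (subvP (addvSl _ _)); apply: memv_line.
  have iG' : i \in (G :\ o)%SET by rewrite !inE io.
  have -> : lift1 (x i) = (- h o / (h i - h o))^-1 *:
      (lift1 (y i) - (h i / (h i - h o)) *: lift1 (x o)).
    have aux (u v : 'rV[R]_(m + 1)) : u + v - u = v by rewrite addrAC subrr add0r.
    by rewrite yE // aux scalerA mulVf ?scale1r // gt_eqF ?cut_coef_gt0.
  apply: memvZ; rewrite addrC; apply: memv_add.
    by rewrite memvN memvZ // memv_line.
  exact: mem_hspan.
rewrite subv_add -memvE mem_hspan //=; apply: hspan_sub => i iG.
have io := no i iG; rewrite yE //; apply: memvD; apply: memvZ; apply: mem_hspan => //.
by move: iG; rewrite !inE => /andP[].
Qed.

(** A functional exposing a face of the section is turned into one that vanishes at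
[x o] by adding a multiple of the functional of the hyperplane; this does not
change it on the section, and its sign at [x i] is that at [cut i]. *)
Lemma face_cut F : face (hull x T `&` hyperplane c b) F <->
  exists G, [/\ exposed x T G, o \in G & F = hull y (G :\ o)%SET].
Proof.
have QH : hull x T `&` hyperplane c b = hull y (T :\ o)%SET.
  by rewrite -hull_cut ?finset.setD11 // finset.setD1K ?finset.in_setT.
split=> [|[G [eG oG ->]]]; last first.
  have /face_hullP [c' [b' [c'b' E]]] : exists2 X, exposed x T X & hull x G = hull x X by exists G.
  exists c', b'; split; first by move=> p [/c'b'].
  rewrite -hull_cut ?finset.setD11 // finset.setD1K // E.
  by rewrite -!setIA [hyperplane c b `&` _]setIC.
rewrite QH => /face_hullP [X [g [gX XE]] ->].
(* [s] is chosen so that [g'] vanishes at [x o]. *)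
have [g0 g0E] := affine_ev c b.
pose s := - ev g (x o) / h o.
pose g' := g + s *: g0.
have g'o : ev g' (x o) = 0.
  by rewrite evD evZ g0E -/(h o) /s divfK ?addrN // lt_eqF.
have g'y i : i != o -> ev g (y i) = - h o / (h i - h o) * ev g' (x i).
  move=> io; have := ev_cut g' io; rewrite g'o mulr0 add0r => <-.
  by rewrite evD evZ g0E dot_cut // subrr mulr0 addr0.
exists [set i in T | ev g' (x i) == 0]%SET; split.
- exists g'; split => // i _; have [->|io] := eqVneq i o; first by rewrite g'o.
  have := gX i; rewrite !inE io => /(_ isT); rewrite g'y //.
  by rewrite pmulr_rle0 // cut_coef_gt0.
- by rewrite !inE g'o eqxx.
congr hull; rewrite XE; apply/setP => i; rewrite !inE !andbT.
have [->//|io] /= := eqVneq i o; rewrite g'y // mulf_eq0 gt_eqF //.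
exact: cut_coef_gt0.
Qed.

Lemma faces_cut (k : nat) F : faces (hull x T `&` hyperplane c b) (k%:Z - 1) F <->
  exists G, [/\ exposed x T G, o \in G, rk x G = k.+1 & F = hull y (G :\ o)%SET].
Proof.
split=> [[/face_cut [G [eG oG ->]]]|[G [eG oG rG ->]]].
  by move=> /has_dim_hull E; exists G; split => //; rewrite rk_cut //; lia.
split; first by apply/face_cut; exists G.
by apply/has_dim_hull; move: rG; rewrite rk_cut // => -[->].
Qed.

Lemma has_dim_cut (k : nat) : rk x T = k.+1 ->
  has_dim (hull x T `&` hyperplane c b) (k%:Z - 1).
Proof.
move=> rT; have : faces (hull x T `&` hyperplane c b) (k%:Z - 1) (hull y (T :\ o)%SET).
  by apply/faces_cut; exists T; split => //; exact: exposed_refl.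
by move=> [_]; rewrite -hull_cut ?finset.setD11 // finset.setD1K ?finset.in_setT.
Qed.

Hypothesis edges : forall i, exposed x T [set o; i]%SET.

(** On the edge from [x o] to [x k] the functional of this edge vanishes; were
[cut i] there, it would vanish at [x i] as well. *)
Lemma cut_inj i k : i != o -> k != o -> y i = y k -> i = k.
Proof.
move=> io ko E; have [g [gT gE]] := edges k.
have zero l : (ev g (x l) == 0) = (l == o) || (l == k).
  by have /setP /(_ l) := gE; rewrite !inE /= => <-.
have go : ev g (x o) = 0 by apply/eqP; rewrite zero eqxx.
have gk : ev g (x k) = 0 by apply/eqP; rewrite zero eqxx orbT.
have : ev g (y i) = 0 by rewrite E ev_cut // go gk !mulr0 addr0.
rewrite ev_cut // go mulr0 add0r => /eqP; rewrite mulf_eq0 gt_eqF ?cut_coef_gt0 //=.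
by rewrite zero (negPf io) => /eqP.
Qed.

Lemma vertex_cut v : vertex (hull x T `&` hyperplane c b) v <->
  exists2 i, i != o & v = y i.
Proof.
split=> [/face_cut [G [eG oG E]]|[i io ->]].
  have [G0|[i iG]] := finset.set_0Vmem (G :\ o)%SET.
    by exfalso; have : [set v] v by []; rewrite E G0 hull0.
  exists i; first by move: iG; rewrite !inE => /andP[].
  by have := mem_hull y iG; rewrite -E => ->.
apply/face_cut; exists [set o; i]%SET; split => //; first by rewrite !inE eqxx.
have -> : ([set o; i] :\ o)%SET = [set i]%SET; last by rewrite hull1.
apply/setP => k; rewrite !inE; have [->|//] := eqVneq k o.
by rewrite eq_sym (negPf io).
Qed.

End VertexFigure.

Section VertexFigureOfBraxtope.
Variables (R : realType) (m n d : nat) (xs : seq 'rV[R]_m).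
Hypothesis (sn : size xs = n.+1).
Local Notation x := (vtx xs (N:=n.+1)).
Local Notation T := [set: 'I_n.+1]%SET.
Hypotheses (d3 : (3 <= d)%N) (dn : (d <= n)%N).
Hypotheses (cpx : convex_position x) (rT : rk x T = d.+1).
Hypothesis facetP : forall X, exposed x T X /\ rk x X = d <-> brax_facet d X.
Variables (c : 'rV[R]_m) (b : R).
Hypothesis sep : separates_vertex (hull x T) (pt xs 0) c b.
Local Notation P := (hull x T `&` hyperplane c b).
Local Notation y := (cut x ord0 c b).

Definition figure_vertices := [seq y (lift ord0 u) | u <- enum 'I_n].
Local Notation ys := figure_vertices.

Lemma pt_ord0 : pt xs 0 = x ord0.
Proof. by rewrite /pt /= min0n. Qed.

Lemma sep_below : dot c (x ord0) < b.
Proof. by rewrite -pt_ord0; case: sep. Qed.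

Lemma sep_above i : i != ord0 -> b < dot c (x i).
Proof.
move=> i0; have [_] := sep; apply; first by apply/vertex_hull => //; exists i; rewrite ?inE.
by rewrite pt_ord0 => /(point_inj cpx) /eqP; rewrite (negPf i0).
Qed.

Lemma edge_exposed i : exposed x T [set ord0; i]%SET.
Proof.
have [->|i0] := eqVneq i ord0.
  by rewrite finset.setUid; exact: cpx.
have i0' : (0 < i)%N by rewrite lt0n.
by have [] := short_exposed d3 dn rT facetP (short_edge d3 dn i0').
Qed.

Lemma size_figure : size ys = n.
Proof. by rewrite size_map size_enum_ord. Qed.

Lemma nth_figure (k : 'I_n.+1) : k != ord0 -> nth 0 ys k.-1 = y k.
Proof.
move=> k0; have k0' : (0 < k)%N by rewrite lt0n.
have kn : (k.-1 < n)%N by have := ltn_ord k; lia.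
rewrite (nth_map (Ordinal kn)) ?size_enum_ord // (nth_ord_enum _ (Ordinal kn)).
by congr y; apply: val_inj; rewrite /= /bump /=; lia.
Qed.

Lemma figure_array : vertex_array ys P.
Proof.
have lift0 (u : 'I_n) : lift ord0 u != ord0 by rewrite eq_sym neq_lift.
have vP := vertex_cut sep_below sep_above edge_exposed.
split.
- have -> : P = hull y (T :\ ord0)%SET; last exact: polytope_hull.
  by rewrite -(hull_cut sep_below sep_above) ?finset.setD11 // finset.setD1K ?finset.in_setT.
- rewrite map_inj_in_uniq ?enum_uniq // => u v _ _.
  by move=> /(cut_inj sep_below sep_above edge_exposed (lift0 u) (lift0 v)) /lift_inj.
apply/seteqP; split=> v.
  by move=> /mapP [u _ ->]; apply/vP; exists (lift ord0 u).
move=> /vP [i i0 ->]; rewrite /= -nth_figure //; apply: mem_nth; rewrite size_figure.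
have i0' : (0 < i)%N by rewrite lt0n.
by have := ltn_ord i; lia.
Qed.

(** The facets through [x_0]. The simplex [T_0] takes the place of [E_1], in
agreement with the truncation of indices in a multiplex. *)
Definition figure_facet i : {set 'I_n.+1} := if i == 0%N then Tset n d 0 else Eset n d i.+1.

Lemma figure_facetE (i : nat) : (i < n)%N ->
  conv [set pt ys t | t in
     [set t : int | i%:Z - (d%:Z - 1) + 1 <= t <= i%:Z + (d%:Z - 1) - 1 /\ t <> i%:Z]]
  = hull y (figure_facet i :\ ord0)%SET.
Proof.
move=> i_n; have sy : size ys = n.-1.+1 by rewrite size_figure; lia.
apply: conv_hull; apply/seteqP; split.
  move=> _ [t /= [tw ti] <-].
  have [k [kn pk kt]] : exists k : nat, [/\ (k < n)%N, pt ys t = nth 0 ys k &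
      [\/ t < 0 /\ k = 0%N, t = k%:Z | (n%:Z <= t) /\ k.+1 = n]].
    case: t tw ti => t tw ti.
      have [tn|tn] := ltnP t n.
        by exists t; split => //; [rewrite (pt_nat sy) //; lia | constructor 2].
      exists n.-1; split; first by lia.
        by rewrite (pt_large sy) //; lia.
      by constructor 3; lia.
    by exists 0%N; split => //; [lia | constructor 1; split; lia].
  have kn' : (k.+1 < n.+1)%N by [].
  exists (Ordinal kn'); last by rewrite pk -(@nth_figure (Ordinal kn')).
  rewrite /= finset.in_setD1 /figure_facet; apply/andP; split => //.
  by case: eqP => i0; rewrite !inE /=; case: kt => [[t0 k0]|tk|[tn kn1]]; lia.
move=> _ [k /= ] /[swap] <-; rewrite finset.in_setD1 => /andP[k0 kG].
have kn := ltn_ord k; have kpos : (0 < k)%N by rewrite lt0n.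
rewrite -nth_figure //; move: kG; rewrite /figure_facet.
case: eqP => i0; rewrite !inE => kG.
  have [k1|k1] := eqVneq (k : nat) 1%N.
    by exists (-1); rewrite /= ?k1 //; split; lia.
  exists k.-1%:Z; first by rewrite /=; split; lia.
  by rewrite (pt_nat sy) //; lia.
have [k1|k1] := eqVneq (k : nat) i.+1.
  exists n%:Z; first by rewrite /=; split; lia.
  by rewrite (pt_large sy); [congr nth|]; lia.
exists k.-1%:Z; first by rewrite /=; split; lia.
by rewrite (pt_nat sy) //; lia.
Qed.

Lemma figure_multiplex : multiplex (d%:Z - 1) ys P.
Proof.
split; first exact: figure_array.
  by apply: (has_dim_cut sep_below sep_above); rewrite rT.
have -> : last_index ys = n%:Z - 1 by rewrite /last_index size_figure.
have fG i : (i < n)%N -> brax_facet d (figure_facet i) /\ ord0 \in figure_facet i.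
  move=> i_n; rewrite /figure_facet; case: eqP => i0.
    by split; [left; exists 0%N => //; lia | rewrite inE /=; lia].
  by split; [right; exists i.+1 => //; lia | rewrite inE].
have dE : d%:Z - 1 - 1 = d.-1%:Z - 1 by lia.
apply/seteqP; split=> F.
  rewrite /facets dE => /(faces_cut sep_below sep_above) [G [eG oG rG ->]].
  have /facetP bG : exposed x T G /\ rk x G = d by split => //; rewrite rG; lia.
  have [i i_n ->] : exists2 i, (i < n)%N & G = figure_facet i.
    case: bG oG => [[i idn ->]|[j jn ->]].
      rewrite inE /= => i0; exists 0%N; first by lia.
      by rewrite /figure_facet eqxx; congr Tset; lia.
    move=> _; exists j.-1; first by lia.
    rewrite /figure_facet ifF; last by apply/eqP; lia.
    by congr Eset; lia.
  by exists i%:Z; [rewrite /=; lia | exact: figure_facetE].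
move=> [t /= tn <-]; case: t tn => i tn; last by lia.
have i_n : (i < n)%N by lia.
have [bG oG] := fG i i_n; have [eG rG] := (facetP _).2 bG.
rewrite figure_facetE // /facets dE; apply/(faces_cut sep_below sep_above).
by exists (figure_facet i); split => //; rewrite rG; lia.
Qed.

Lemma figure_edge (u : nat) : (1 <= u <= n)%N ->
  edge (hull x T) (pt xs 0) (nth 0 xs u) /\
  segment (pt xs 0) (nth 0 xs u) `&` hyperplane c b = [set nth 0 ys u.-1].
Proof.
move=> un; have uN : (u < n.+1)%N by lia.
pose u' := Ordinal uN; have u0 : u' != ord0 by rewrite -val_eqE /=; lia.
have -> : nth 0 ys u.-1 = y u' by rewrite -(nth_figure u0).
have -> : nth 0 xs u = x u' by [].
rewrite pt_ord0.
have segE : segment (x ord0) (x u') = hull x [set ord0; u']%SET.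
  apply: conv_hull; apply/seteqP; split=> [v [->|->]|_ [k + <-]].
  - by exists ord0; rewrite //= !inE eqxx.
  - by exists u'; rewrite //= !inE eqxx orbT.
  by rewrite /= !inE => /orP[] /eqP ->; [left | right].
have u0' : (0 < u')%N by rewrite /=; lia.
have [iE eE] := short_exposed d3 dn rT facetP (short_edge d3 dn u0').
split; last rewrite segE.
  split.
  - by move=> /(point_inj cpx) /eqP; rewrite eq_sym (negPf u0).
  - by rewrite segE; apply/face_hullP; exists [set ord0; u']%SET.
  rewrite segE; apply/has_dim_hull; rewrite (eqP iE) cards2 eq_sym u0 /=; lia.
rewrite (hull_cut sep_below sep_above) ?hull1 // inE eq_sym; exact: u0.
Qed.

End VertexFigureOfBraxtope.

(** * The theorem *)

Theorem theorem3 (R : realType) (m n d : nat)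
    (xs : seq 'rV[R]_m) (Q : set 'rV[R]_m)
    (hd : (3 <= d)%N) (hn : (d <= n)%N) (hxs : size xs = n.+1)
    (hQ : braxtope d%:Z xs Q) :
  [/\ [/\ polytope Q, has_dim Q d%:Z & braxial xs Q],
      forall (c : 'rV[R]_m) (b : R), separates_vertex Q (pt xs 0) c b ->
        exists ys : seq 'rV[R]_m,
          [/\ size ys = n,
              forall u : nat, (1 <= u <= n)%N ->
                edge Q (pt xs 0) (nth 0 xs u) /\
                segment (pt xs 0) (nth 0 xs u) `&` hyperplane c b
                  = [set nth 0 ys u.-1] &
              multiplex (d%:Z - 1) ys (Q `&` hyperplane c b)],
      (n <= 2 * d - 3)%N ->
        exists ys : seq 'rV[R]_m,
          [/\ subseq ys xs,
              braxtope (n%:Z - d%:Z + 2) ys (conv [set` ys]) &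
              fold_pyramid (2 * d - 2 - n) (conv [set` ys]) Q],
      forall j : int, -1 <= j <= d%:Z ->
        fnum Q j = (binz (d + 1) (j + 1) +
          (n - d) * (binz (d - 1) j + binz (d - 2) (j - 1)))%N &
      elementary d Q].
Proof.
have [cpx QE rT _ facetP] := (braxtopeP Q hxs hd).1 hQ.
set x := vtx xs (N:=n.+1) in cpx QE rT facetP.
have va : vertex_array xs Q by case: hQ.
have fnumE := fnum_braxtope hd hn cpx rT facetP.
split.
- split; first by case: va.
    by rewrite QE; apply/has_dim_hull; rewrite rT; lia.
  split => // F [fF _].
  by have [k Fk bF] := braxtope_face hQ fF; exists k.
- move=> c b; rewrite QE => sep; exists (figure_vertices n xs c b); split.
  + exact: size_figure.
  + by move=> u un; exact: (figure_edge hxs hd hn cpx rT facetP sep un).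
  + exact: (figure_multiplex hxs hd hn cpx rT facetP sep).
- by move=> nd; apply: braxtope_pyramid hxs hQ; lia.
- by move=> j jd; rewrite QE fnumE.
rewrite QE; apply: elementary_hull => //; first by rewrite hd.
- move=> X eX rX; have fX : face Q (hull x X) by rewrite QE; apply/face_hullP; exists X.
  have [k /has_dim_hull kE bF] := braxtope_face hQ fX.
  move: bF; rewrite kE rX => -[vaX] /= sX.
  have [+ _] := simplex_indep erefl vaX sX.
  by rewrite induced_hull // size_map -cardE => -[].
- by rewrite fnumE /= ?bin1 ?bin0 ?muln1 ?addn0; lia.
rewrite fnumE; last by lia.
have -> : 1 + 1 = 2%:Z by [].
have -> : 1 - 1 = 0%:Z by [].
by rewrite /= bin1 bin0 addn1; congr (_ + _ * _)%N; lia.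
Qed.
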